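(* Let $E\to M$ be a nonzero vector bundle such that both $E$ and its dual $E^*$ are equipped with Lie algebroid structures over $M$. Let $d_*:\Gamma(\wedge^\bullet E)\to\Gamma(\wedge^{\bullet+1}E)$ be the Lie algebroid coboundary operator associated with the Lie algebroid structure on $E^*$. Let $\hat{d_*}:\mathfrak{J}E\to\wedge^2E$ be the bundle map lifting $d_*:\Gamma(E)\to\Gamma(\wedge^2E)$, viewed as a $1$-cochain of the jet Lie algebroid $\mathfrak{J}E$ (induced by the Lie algebroid $E$) with values in the representation $\widetilde{\pi}$ on $\wedge^2E$. Then: 1) The pair $(E,E^* )$ is a Lie bialgebroid if and only if $\hat{d_*}$ is a $1$-cocycle. 2) The pair $(E,E^* )$ is a coboundary Lie bialgebroid (i.e. $d_*=[\tau,\cdot\,]$, for some $\tau\in\Gamma(\wedge^2E)$) if and only if $\hat{d_*}$ is a coboundary.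
   Context: $\mathfrak{D}E$ is the gauge Lie algebroid of $E$: its sections are the $\mathbb{R}$-linear operators $\mathfrak{d}:\Gamma(E)\to\Gamma(E)$ for which there is a vector field $\alpha(\mathfrak{d})$ with $\mathfrak{d}(fu)=f\mathfrak{d}u+\alpha(\mathfrak{d})(f)u$, with commutator bracket and anchor $\alpha$. $\mathfrak{J}E$ is the first jet bundle of $E$; $\mathbf{d}u\in\Gamma(\mathfrak{J}E)$ is the jet of $u\in\Gamma(E)$; $\mathrm{Hom}(TM,E)=T^*M\otimes E$ is the kernel of $\mathfrak{J}E\to E$, embedded so that $\mathbf{d}(fu)=f\,\mathbf{d}u+df\otimes u$. Let $(E,[\cdot,\cdot],\rho_E)$ be the Lie algebroid structure on $E$; $[\cdot,\cdot]$ also denotes its Schouten bracket on $\Gamma(\wedge^\bullet E)$. There is a Lie algebroid structure on $\mathfrak{J}E$ (the jet Lie algebroid) with bracket $[\cdot,\cdot]_\pi$ determined by $$[\mathbf{d}u,\mathbf{d}v]_\pi=\mathbf{d}[u,v],\quad [\mathbf{d}u,df\otimes v]_\pi=d(\rho_E(u)f)\otimes v+df\otimes[u,v],$$ $$[df\otimes u,dg\otimes v]_\pi=\rho_E(u)(g)\,df\otimes v-\rho_E(v)(f)\,dg\otimes u,$$ and a representation (the adjoint representation) $\pi:\mathfrak{J}E\to\mathfrak{D}E$ on $E$, the bundle map with $\pi(\mathbf{d}u)(v)=[u,v]$; the anchor of $\mathfrak{J}E$ is $\alpha\circ\pi$. It induces the tensor representation $\widetilde\pi$ of $\mathfrak{J}E$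 on $\wedge^2E$, $\widetilde\pi(\mu)(v\wedge w)=\pi(\mu)v\wedge w+v\wedge\pi(\mu)w$, so $\widetilde\pi(\mathbf{d}u)(\mathcal{W})=[u,\mathcal{W}]$ for $\mathcal{W}\in\Gamma(\wedge^2E)$. Cocycles and coboundaries are taken in the Lie algebroid cochain complex $\Gamma(\mathrm{Hom}(\wedge^\bullet\mathfrak{J}E,\wedge^2E))$ of $\widetilde\pi$. The bundle map $\hat{d_*}:\mathfrak{J}E\to\wedge^2E$ is defined by $\hat{d_*}(\mathbf{d}u)=d_*u$ and $\hat{d_*}(df\otimes u)=d_*f\wedge u$ for $u\in\Gamma(E)$, $f\in C^\infty(M)$. $(E,E^* )$ is a Lie bialgebroid if $d_*[u,v]=[d_*u,v]+[u,d_*v]$ for all $u,v\in\Gamma(E)$.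
   Formalization: In part 2, d_*=[τ,·] is required only as an equality of maps Γ(E)→Γ(∧²E); for rank ≥ 2 this gives it in all degrees, while in rank 1 the all-degree reading is false (E=T*ℝ with zero bracket, E*=Tℝ: d̂_*=0 but d_*f=df≠0). *)

(* Defs.v *)
From HB Require Import structures.
From mathcomp Require Import all_boot all_order all_algebra.
From mathcomp Require Import ring.
From mathcomp Require Import all_classical all_reals all_analysis.
Set Implicit Arguments. Unset Strict Implicit. Unset Printing Implicit Defensive.
Import Order.TTheory GRing.Theory Num.Theory numFieldNormedType.Exports.
Local Open Scope classical_set_scope.
Local Open Scope ring_scope.

Lemma near_eq_differentiable (R : realType) (V W : normedModType R)
    (f g : V -> W) (x : V) :
  (\forall y \near x, f y = g y) -> differentiable f x -> differentiable g x.
Proof.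
move=> fg df; have [dfc dfx] := (diff_locallyP _ _).1 df.
have gx : g \o shift x = cst (g x) + 'd f x +o_ 0 id.
  apply/eqaddoP => e e0; move/eqaddoP: dfx => /(_ e e0).
  have fg0 : \forall h \near (0 : V), f (h + x) = g (h + x).
    by move/nbhs0P: fg; apply: filterS => h /=; rewrite addrC.
  apply: filterS2 fg0 => h /= fgh.
  by rewrite /GRing.add /GRing.opp /= /GRing.add /GRing.opp /= fgh (nbhs_singleton fg).
apply/diff_locallyP; have -> : 'd g x = 'd f x :> (V -> W) by exact: diff_unique.
by split.
Qed.

Section SmoothOn.
Variables (R : realType) (n : nat).
Implicit Types (U V : set 'rV[R]_n) (f g : 'rV[R]_n -> R).

Definition evec (i : 'I_n) : 'rV[R]_n := delta_mx 0 i.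

Fixpoint Ck (k : nat) U f : Prop :=
  if k is k'.+1 then
    (forall x, U x -> differentiable f x) /\
    (forall i : 'I_n, Ck k' U (fun x => 'D_(evec i) f x))
  else forall x, U x -> {for x, continuous f}.

Definition smooth_on U f := forall k, Ck k U f.

Lemma Ck_sub k U V f : V `<=` U -> Ck k U f -> Ck k V f.
Proof.
move=> VU; elim: k f => [|k IH] f /=; first by move=> h x /VU; exact: h.
by case=> h1 h2; split=> [x /VU /h1 //|i]; exact: IH.
Qed.

Lemma open_near_eq U f g x : open U -> {in U, f =1 g} -> U x ->
  \forall y \near x, f y = g y.
Proof.
move=> oU fg Ux; move: oU; rewrite openE => /(_ _ Ux).
by apply: filterS => y Uy; apply: fg; rewrite inE.
Qed.

Lemma Ck_ext k U f g : open U -> {in U, f =1 g} -> Ck k U f -> Ck k U g.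
Proof.
move=> oU; elim: k f g => [|k IH] f g fg /=.
  move=> h x Ux; have fgx := open_near_eq oU fg Ux.
  have := h _ Ux; rewrite /prop_for /continuous_at -(fg x) ?inE// => fc.
  by apply: cvg_trans fc; exact: near_eq_cvg fgx.
case=> h1 h2; split.
  move=> x Ux; apply: near_eq_differentiable (h1 _ Ux); exact: open_near_eq Ux.
move=> i; apply: (IH (fun x => 'D_(evec i) f x)); last exact: h2.
by move=> x; rewrite inE => Ux; apply: near_eq_derive; exact: open_near_eq Ux.
Qed.

Lemma CkW k U f : Ck k.+1 U f -> Ck k U f.
Proof.
elim: k f => [|k IH] f [h1 h2].
  by move=> x Ux; exact/differentiable_continuous/h1.
by split=> // i; exact: IH.
Qed.

Lemma Ck_cst k U a : Ck k U (fun=> a).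
Proof.
elim: k a => [|k IH] a /=; first by move=> x _; exact: cst_continuous.
split=> [x _|i]; first exact: differentiable_cst.
have -> : (fun x => 'D_(evec i) (fun=> a) x) = (fun=> 0).
  by apply/funext => x; exact: derive_cst.
exact: IH.
Qed.

Lemma CkD k U f g : open U -> Ck k U f -> Ck k U g -> Ck k U (fun x => f x + g x).
Proof.
move=> oU; elim: k f g => [|k IH] f g /=.
  by move=> cf cg x Ux; apply: continuousD; [exact: cf|exact: cg].
move=> [f1 f2] [g1 g2]; split=> [x Ux|i].
  by apply: differentiableD; [exact: f1|exact: g1].
apply: (Ck_ext oU) (IH _ _ (f2 i) (g2 i)) => x; rewrite inE => Ux.
by rewrite [RHS]deriveD//; apply: diff_derivable; [exact: f1|exact: g1].
Qed.

Lemma CkM k U f g : open U -> Ck k U f -> Ck k U g -> Ck k U (fun x => f x * g x).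
Proof.
move=> oU; elim: k f g => [|k IH] f g.
  by move=> cf cg x Ux; apply: continuousM; [exact: cf|exact: cg].
move=> hf hg; have [f1 f2] := hf; have [g1 g2] := hg; split=> [x Ux|i].
  by apply: differentiableM; [exact: f1|exact: g1].
apply: (Ck_ext oU)
  (CkD oU (IH _ _ (CkW hf) (g2 i)) (IH _ _ (CkW hg) (f2 i))) => x.
rewrite inE => Ux.
by rewrite [RHS]deriveM//; apply: diff_derivable; [exact: f1|exact: g1].
Qed.

End SmoothOn.

(* [cmap] and [cinv] are total functions; only their values on [cdom] and on
   its image matter. *)
Record chart (R : realType) (n : nat) (M : Type) := Chart {
  cdom : set M;
  cmap : M -> 'rV[R]_n;
  cinv : 'rV[R]_n -> M }.

Definition chart_img (R : realType) n (M : Type) (c : chart R n M) (V : set M) :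
  set 'rV[R]_n := cmap c @` (cdom c `&` V).

Definition is_chart (R : realType) n (M : topologicalType) (c : chart R n M) :=
  [/\ open (cdom c), open (chart_img c setT),
      forall x, cdom c x -> cinv c (cmap c x) = x,
      forall x, cdom c x -> {for x, continuous (cmap c)} &
      forall y, chart_img c setT y -> {for y, continuous (cinv c)}].

Record manifold (R : realType) (n : nat) := Manifold {
  mcarrier :> topologicalType;
  atlas : set (chart R n mcarrier);
  mfd_hausdorff : hausdorff_space mcarrier;
  mfd_second_countable : @second_countable mcarrier;
  atlas_chart : forall c, atlas c -> is_chart c;
  atlas_cover : forall x, exists2 c, atlas c & cdom c x;
  atlas_compat : forall c d, atlas c -> atlas d -> forall i : 'I_n,
    smooth_on (chart_img c (cdom d)) (fun y => cmap d (cinv c y) 0 i) }.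

Section SmoothFunctions.
Variables (R : realType) (n : nat) (M : manifold R n).
Implicit Types (c : chart R n M) (V : set M) (f g : M -> R).

Lemma open_chart_img c V : atlas c -> open V -> open (chart_img c V).
Proof.
move=> /atlas_chart [oc oi cK cc ci] oV; rewrite openE => y [x [cx Vx] <-{y}].
have xi : chart_img c setT (cmap c x) by exists x.
have cix : cinv c @ cmap c x --> cinv c (cmap c x) := ci _ xi.
rewrite (cK _ cx) in cix.
have nV : nbhs (cmap c x) (cinv c @^-1` V).
  by apply: cix; move: oV; rewrite openE; exact.
have nI : nbhs (cmap c x) (chart_img c setT).
  by move: oi; rewrite openE; exact.
rewrite /interior; near=> y.
have [x' [cx' _] x'y] : chart_img c setT y by near: y.
have Vy : V (cinv c y) by near: y.
by exists x' => //; split=> //; rewrite -(cK x')// x'y.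
Unshelve. all: by end_near. Qed.

(* [f] is smooth on the part of [V] covered by the chart [c]. *)
Definition smooth_in c V f := smooth_on (chart_img c V) (f \o cinv c).

Lemma smooth_in_sub c V V' f : V' `<=` V -> smooth_in c V f -> smooth_in c V' f.
Proof.
by move=> VV' h k; apply: Ck_sub (h k) => y [x [cx Vx] <-]; exists x => //; split=> //; exact: VV'.
Qed.

Lemma smooth_in_ext c V f g : atlas c -> open V -> {in V, f =1 g} ->
  smooth_in c V f -> smooth_in c V g.
Proof.
move=> ac oV fg h k; apply: Ck_ext (h k); first exact: open_chart_img.
move=> y; rewrite inE => -[x [cx Vx] <-] /=.
have [_ _ cK _ _] := atlas_chart ac.
by rewrite cK// fg ?inE.
Qed.

Lemma smooth_in_cst c V a : smooth_in c V (fun=> a).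
Proof. by move=> k; exact: Ck_cst. Qed.

Lemma smooth_inD c V f g : atlas c -> open V ->
  smooth_in c V f -> smooth_in c V g -> smooth_in c V (fun x => f x + g x).
Proof. by move=> ac oV hf hg k; apply: CkD => //; exact: open_chart_img. Qed.

Lemma smooth_inM c V f g : atlas c -> open V ->
  smooth_in c V f -> smooth_in c V g -> smooth_in c V (fun x => f x * g x).
Proof. by move=> ac oV hf hg k; apply: CkM => //; exact: open_chart_img. Qed.

Record smooth_fun := SmoothFun {
  sfun :> M -> R;
  sfun_smooth : forall c, atlas c -> smooth_in c setT sfun }.

Lemma smooth_funP (f g : smooth_fun) : (forall x, f x = g x) -> f = g.
Proof.
case: f g => f hf [g hg] /= /funext fg; case: _ / fg hg => hg.
by congr SmoothFun; exact: Prop_irrelevance.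
Qed.

Definition sf_cst (a : R) : smooth_fun :=
  SmoothFun (fun c _ => @smooth_in_cst c setT a).
Definition sf_add (f g : smooth_fun) : smooth_fun :=
  SmoothFun (fun c ac => smooth_inD ac openT (sfun_smooth f ac) (sfun_smooth g ac)).
Definition sf_mul (f g : smooth_fun) : smooth_fun :=
  SmoothFun (fun c ac => smooth_inM ac openT (sfun_smooth f ac) (sfun_smooth g ac)).
Definition sf_opp (f : smooth_fun) : smooth_fun := sf_mul (sf_cst (-1)) f.

HB.instance Definition _ := gen_eqMixin smooth_fun.
HB.instance Definition _ := gen_choiceMixin smooth_fun.

Fact sf_addA : associative sf_add.
Proof. by move=> f g h; apply: smooth_funP => x /=; rewrite addrA. Qed.
Fact sf_addC : commutative sf_add.
Proof. by move=> f g; apply: smooth_funP => x /=; rewrite addrC. Qed.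
Fact sf_add0 : left_id (sf_cst 0) sf_add.
Proof. by move=> f; apply: smooth_funP => x /=; rewrite add0r. Qed.
Fact sf_addN : left_inverse (sf_cst 0) sf_opp sf_add.
Proof. by move=> f; apply: smooth_funP => x /=; rewrite mulN1r addNr. Qed.
HB.instance Definition _ :=
  GRing.isZmodule.Build smooth_fun sf_addA sf_addC sf_add0 sf_addN.

Fact sf_mulA : associative sf_mul.
Proof. by move=> f g h; apply: smooth_funP => x /=; rewrite mulrA. Qed.
Fact sf_mulC : commutative sf_mul.
Proof. by move=> f g; apply: smooth_funP => x /=; rewrite mulrC. Qed.
Fact sf_mul1 : left_id (sf_cst 1) sf_mul.
Proof. by move=> f; apply: smooth_funP => x /=; rewrite mul1r. Qed.
Fact sf_mulD : left_distributive sf_mul sf_add.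
Proof. by move=> f g h; apply: smooth_funP => x /=; rewrite mulrDl. Qed.
(* Only a [comPzRingType]: the ring is trivial when M is empty. *)
HB.instance Definition _ :=
  GRing.Zmodule_isComPzRing.Build smooth_fun sf_mulA sf_mulC sf_mul1 sf_mulD.

Lemma sfunD (f g : smooth_fun) x : (f + g) x = f x + g x. Proof. by []. Qed.
Lemma sfunM (f g : smooth_fun) x : (f * g) x = f x * g x. Proof. by []. Qed.
Lemma sfun0 x : (0 : smooth_fun) x = 0. Proof. by []. Qed.
Lemma sfun1 x : (1 : smooth_fun) x = 1. Proof. by []. Qed.
Lemma sfunN (f : smooth_fun) x : (- f) x = - f x.
Proof. exact: mulN1r. Qed.

(* A family of real vector spaces over M together with a
   [smooth_fun]-module of sections declared to be smooth. *)
Record section_family := SectionFamily {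
  fibre :> M -> lmodType R;
  smooth_sec : (forall x, fibre x) -> Prop;
  smooth_sec0 : smooth_sec (fun=> 0);
  smooth_secD : forall (f : smooth_fun) s t, smooth_sec s -> smooth_sec t ->
    smooth_sec (fun x => f x *: s x + t x) }.

Variable F : section_family.

Record Gamma := GammaSec {
  sval :> forall x, F x;
  sval_smooth : smooth_sec sval }.

Lemma GammaP (s t : Gamma) : (forall x, s x = t x) -> s = t.
Proof.
case: s t => s hs [t ht] /= st0.
have st : s = t by exact: functional_extensionality_dep.
by case: _ / st ht {st0} => ht; congr GammaSec; exact: Prop_irrelevance.
Qed.

Fact smooth_secDD (s t : Gamma) : smooth_sec (fun x => s x + t x).
Proof.
have := smooth_secD (sf_cst 1) (sval_smooth s) (sval_smooth t).
by congr smooth_sec; apply: functional_extensionality_dep => x /=; rewrite scale1r.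
Qed.
Fact smooth_secZ (f : smooth_fun) (s : Gamma) : smooth_sec (fun x => f x *: s x).
Proof.
have := smooth_secD f (sval_smooth s) (smooth_sec0 F).
by congr smooth_sec; apply: functional_extensionality_dep => x /=; rewrite addr0.
Qed.

Definition sec_zero : Gamma := GammaSec (smooth_sec0 F).
Definition sec_add (s t : Gamma) : Gamma := GammaSec (smooth_secDD s t).
Definition sec_scale (f : smooth_fun) (s : Gamma) : Gamma := GammaSec (smooth_secZ f s).
Definition sec_opp (s : Gamma) : Gamma := sec_scale (sf_cst (-1)) s.

HB.instance Definition _ := gen_eqMixin Gamma.
HB.instance Definition _ := gen_choiceMixin Gamma.

Fact sec_addA : associative sec_add.
Proof. by move=> f g h; apply: GammaP => x /=; rewrite addrA. Qed.
Fact sec_addC : commutative sec_add.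
Proof. by move=> f g; apply: GammaP => x /=; rewrite addrC. Qed.
Fact sec_add0 : left_id sec_zero sec_add.
Proof. by move=> f; apply: GammaP => x /=; rewrite add0r. Qed.
Fact sec_addN : left_inverse sec_zero sec_opp sec_add.
Proof. by move=> f; apply: GammaP => x /=; rewrite scaleN1r addNr. Qed.
HB.instance Definition _ :=
  GRing.isZmodule.Build Gamma sec_addA sec_addC sec_add0 sec_addN.

Fact sec_scaleA (f g : smooth_fun) s : sec_scale f (sec_scale g s) = sec_scale (f * g) s.
Proof. by apply: GammaP => x /=; rewrite scalerA. Qed.
Fact sec_scale1 : left_id 1 sec_scale.
Proof. by move=> s; apply: GammaP => x /=; rewrite scale1r. Qed.
Fact sec_scaleDr : right_distributive sec_scale +%R.
Proof. by move=> f s t; apply: GammaP => x /=; rewrite scalerDr. Qed.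
Fact sec_scaleDl s : {morph sec_scale^~ s : f g / f + g}.
Proof. by move=> f g; apply: GammaP => x /=; rewrite scalerDl. Qed.
HB.instance Definition _ := GRing.Zmodule_isLmodule.Build smooth_fun Gamma
  sec_scaleA sec_scale1 sec_scaleDr sec_scaleDl.

Lemma svalD (s t : Gamma) x : (s + t) x = s x + t x. Proof. by []. Qed.
Lemma svalZ (f : smooth_fun) (s : Gamma) x : (f *: s) x = f x *: s x.
Proof. by []. Qed.

End SmoothFunctions.

(* As for charts, only the values of [tmap] and [tinv] over [tdom] matter. *)
Record ltriv (R : realType) (M : Type) (F : M -> lmodType R) (r : nat) := LTriv {
  tdom : set M;
  tmap : forall x, F x -> 'rV[R]_r;
  tinv : forall x, 'rV[R]_r -> F x }.

Record vbundle (R : realType) n (M : manifold R n) (r : nat) := VBundle {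
  vfibre :> M -> lmodType R;
  trivs : set (ltriv vfibre r);
  triv_open : forall t, trivs t -> open (tdom t);
  triv_cover : forall x, exists2 t, trivs t & tdom t x;
  triv_linear : forall t x, trivs t -> tdom t x ->
    forall (a : R) (v w : vfibre x),
      tmap t (a *: v + w) = a *: tmap t v + tmap t w;
  triv_mapK : forall t x, trivs t -> tdom t x -> cancel (@tmap _ _ _ _ t x) (@tinv _ _ _ _ t x);
  triv_invK : forall t x, trivs t -> tdom t x -> cancel (@tinv _ _ _ _ t x) (@tmap _ _ _ _ t x);
  triv_compat : forall s t, trivs s -> trivs t -> forall (i j : 'I_r) c, atlas c ->
    smooth_in c (tdom s `&` tdom t)
      (fun x => tmap t (tinv s x (delta_mx 0 i)) 0 j) }.

Section Bundles.
Variables (R : realType) (n : nat) (M : manifold R n) (r : nat) (E : vbundle M r).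

Definition vb_smooth (s : forall x, E x) := forall t c (j : 'I_r),
  trivs t -> atlas c -> smooth_in c (tdom t) (fun x => tmap t (s x) 0 j).

Fact vb_smooth0 : vb_smooth (fun=> 0).
Proof.
move=> t c j ht hc; apply: (smooth_in_ext hc (triv_open ht) _ (@smooth_in_cst _ _ _ c _ 0)).
move=> x; rewrite inE => tx; have := triv_linear ht tx (-1) 0 0.
by rewrite scaler0 addr0 scaleN1r addNr => ->; rewrite mxE.
Qed.

Fact vb_smoothD (f : smooth_fun M) s t : vb_smooth s -> vb_smooth t ->
  vb_smooth (fun x => f x *: s x + t x).
Proof.
move=> hs ht t' c j ht' hc; have ot := triv_open ht'.
have hf := smooth_in_sub (@subsetT _ (tdom t')) (sfun_smooth f hc).
apply: (smooth_in_ext hc ot _ (smooth_inD hc ot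
  (smooth_inM hc ot hf (hs t' c j ht' hc)) (ht t' c j ht' hc))).
by move=> x; rewrite inE => tx; rewrite triv_linear// !mxE.
Qed.

(* The smooth sections of E. *)
Definition vb_sections : section_family M := SectionFamily vb_smooth0 vb_smoothD.

(* The 1-jet at x of a section u is encoded by the family of its first-order
   Taylor data (value, partial derivatives) at x in all the charts and local
   trivializations around x.  Thus jet1 u x = jet1 v x iff u and v have the same
   1-jet at x, and the fibre at x of the jet bundle is the space
   { jet1 u x | u a smooth section of E }, which is the quotient of the space of
   sections by the sections whose 1-jet at x vanishes. *)

Definition jet_data : lmodType R :=
  chart R n M -> ltriv E r -> ('rV[R]_r * 'M[R]_(n, r))%type.

Definition jet1 (u : forall x, E x) (x : M) : jet_data := fun c t =>
  if `[< [/\ atlas c, trivs t, cdom c x & tdom t x] >] then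
    (tmap t (u x),
     \matrix_(i < n, j < r)
       'D_(evec R i) (fun y => tmap t (u (cinv c y)) 0 j) (cmap c x))
  else 0.

(* A section of the jet bundle is smooth when its components in the
   coordinates induced by every chart and every local trivialization are. *)
Definition jet_smooth (mu : M -> jet_data) :=
  (forall x, exists u : Gamma vb_sections, mu x = jet1 u x) /\
  (forall c t, atlas c -> trivs t ->
     (forall j : 'I_r, smooth_in c (tdom t) (fun x => (mu x c t).1 0 j)) /\
     (forall (i : 'I_n) (j : 'I_r),
        smooth_in c (tdom t) (fun x => (mu x c t).2 i j))).

Lemma jet1D (a : R) (u v : Gamma vb_sections) x :
  jet1 (sf_cst M a *: u + v) x = a *: jet1 u x + jet1 v x.
Proof.
apply/funext => c; apply/funext => t; rewrite -[RHS]/(a *: jet1 u x c t + jet1 v x c t) /jet1.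
case: asboolP => [[hc ht cx tx]|_]; last by rewrite scaler0 addr0.
apply: injective_projections => /=; first by rewrite triv_linear.
apply/matrixP => i j; rewrite !mxE.
have ot := triv_open ht.
have oi := open_chart_img hc ot.
have ix : chart_img c (tdom t) (cmap c x) by exists x.
have [_ _ cK _ _] := atlas_chart hc.
have dif (w : Gamma vb_sections) :
    derivable (fun y => tmap t (w (cinv c y)) 0 j) (cmap c x) (evec R i).
  by apply: diff_derivable; have [+ _] := @sval_smooth _ _ _ _ w t c j ht hc 1; exact.
rewrite (@near_eq_derive _ _ _ _ (a \*: (fun y => tmap t (u (cinv c y)) 0 j) +
  (fun y => tmap t (v (cinv c y)) 0 j))).
  by rewrite deriveD ?deriveZ//; exact: derivableZ.
have nb : nbhs (cmap c x) (chart_img c (tdom t)) by exact: open_nbhs_nbhs.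
apply: filterS nb => y [z [cz tz] <-].
rewrite -[RHS]/(a * tmap t (u (cinv c (cmap c z))) 0 j +
  tmap t (v (cinv c (cmap c z))) 0 j) cK//.
by rewrite triv_linear// !mxE.
Qed.

Fact jet_smooth0 : jet_smooth (fun=> 0).
Proof.
split=> [x|c t hc ht].
  exists 0; have := jet1D (-1) 0 0 x.
  by rewrite scaler0 addr0 scaleN1r addNr.
by split=> [j|i j];
  apply: (smooth_in_ext hc (triv_open ht) _ (@smooth_in_cst _ _ _ c _ 0)) => x _;
  rewrite mxE.
Qed.

Fact jet_smoothD (f : smooth_fun M) mu nu : jet_smooth mu -> jet_smooth nu ->
  jet_smooth (fun x => f x *: mu x + nu x).
Proof.
move=> [m1 m2] [n1 n2]; split=> [x|c t hc ht].
  have [u ->] := m1 x; have [v ->] := n1 x.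
  by exists (sf_cst M (f x) *: u + v); rewrite jet1D.
have ot := triv_open ht.
have hf := smooth_in_sub (@subsetT _ (tdom t)) (sfun_smooth f hc).
have [m3 m4] := m2 _ _ hc ht; have [n3 n4] := n2 _ _ hc ht.
split=> [j|i j].
- apply: (smooth_in_ext hc ot _ (smooth_inD hc ot (smooth_inM hc ot hf (m3 j)) (n3 j))).
  by move=> x _; rewrite !mxE.
- apply: (smooth_in_ext hc ot _ (smooth_inD hc ot (smooth_inM hc ot hf (m4 i j)) (n4 i j))).
  by move=> x _; rewrite !mxE.
Qed.

Definition jet_sections : section_family M := SectionFamily jet_smooth0 jet_smoothD.

Fact jet1_smooth (u : Gamma vb_sections) : jet_smooth (jet1 u).
Proof.
split=> [x|c t hc ht]; first by exists u.
have ot := triv_open ht; have oi := open_chart_img hc ot.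
have [_ _ cK _ _] := atlas_chart hc.
have jetE x : cdom c x -> tdom t x -> jet1 u x c t =
    (tmap t (u x), \matrix_(i < n, j < r)
       'D_(evec R i) (fun y => tmap t (u (cinv c y)) 0 j) (cmap c x)).
  by move=> cx tx; rewrite /jet1 asboolT.
split=> [j k|i j k].
  apply: Ck_ext oi _ (@sval_smooth _ _ _ _ u t c j ht hc k) => y.
  by rewrite inE => -[x [cx tx] <-] /=; rewrite cK// jetE.
have [_ /(_ i)] := @sval_smooth _ _ _ _ u t c j ht hc k.+1.
apply: Ck_ext oi _ => y; rewrite inE => -[x [cx tx] <-] /=.
by rewrite (cK _ cx) jetE// mxE.
Qed.

Definition jet (u : Gamma vb_sections) : Gamma jet_sections :=
  GammaSec (F := jet_sections) (jet1_smooth u).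

End Bundles.

(* Everything below is expressed on the modules of smooth sections over the ring
   C^oo(M) of smooth functions: bundle maps are C^oo(M)-linear maps between
   modules of sections, and sections of dual, Hom- and exterior bundles are
   C^oo(M)-multilinear maps. *)

Section Algebroids.
Variables (R : realType) (n : nat) (M : manifold R n).
Local Notation A := (smooth_fun M).

(* Vector fields on M, as derivations of the R-algebra C^oo(M); [sf_cst M a] is
   the constant function a, so [vf_lin] is R-linearity. *)
Record vfield := VField {
  vf :> A -> A;
  vf_lin : forall (a : R) (f g : A), vf (sf_cst M a * f + g) = sf_cst M a * vf f + vf g;
  vf_leib : forall f g : A, vf (f * g) = f * vf g + vf f * g }.

(* Sections of the gauge Lie algebroid of the bundle with module of sections W;
   [symb] is the anchor of the gauge Lie algebroid. *)
Record derop (W : lmodType A) := Derop {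
  dop :> W -> W;
  symb : vfield;
  dop_lin : forall (a : R) (u v : W),
    dop (sf_cst M a *: u + v) = sf_cst M a *: dop u + dop v;
  dop_leib : forall (f : A) (u : W), dop (f *: u) = f *: dop u + symb f *: u }.

Definition derop_linear (V W : lmodType A) (p : V -> derop W) :=
  forall (f : A) (u v : V),
    (forall w, p (f *: u + v) w = f *: p u w + p v w) /\
    (forall g, symb (p (f *: u + v)) g = f * symb (p u) g + symb (p v) g).

Record lie_algebroid (V : lmodType A) := LieAlgebroid {
  br : V -> V -> V;
  anchor : V -> vfield;
  br_lin : forall (a : R) (u v w : V),
    br (sf_cst M a *: u + v) w = sf_cst M a *: br u w + br v w;
  br_skew : forall u v, br u v = - br v u;
  br_jacobi : forall u v w, br u (br v w) + br v (br w u) + br w (br u v) = 0;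
  br_leib : forall (f : A) (u v : V), br u (f *: v) = f *: br u v + anchor u f *: v;
  anchor_lin : forall (f : A) (u v : V) (g : A),
    anchor (f *: u + v) g = f * anchor u g + anchor v g;
  anchor_br : forall (u v : V) (g : A),
    anchor (br u v) g = anchor u (anchor v g) - anchor v (anchor u g) }.

Lemma br_comb (V : lmodType A) (L : lie_algebroid V) (f : A) u v w :
  br L (f *: u + v) w = f *: br L u w + (- (anchor L w f *: u) + br L v w).
Proof.
have bD a b c : br L (a + b) c = br L a c + br L b c.
  have := br_lin L 1 a b c.
  have -> : sf_cst M 1 = 1 :> A by [].
  by rewrite !scale1r.
by rewrite bD (br_skew L (f *: u)) br_leib opprD -scalerN -br_skew addrA.
Qed.

(* Coboundary operators, in degrees 0 and 1, of the cochain complex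
   Gamma(Hom(wedge^k V, W)) of a Lie algebroid V with values in W. *)
Definition ce0 (V W : lmodType A) (p : V -> derop W) (w : W) : V -> W :=
  fun v => p v w.
Definition ce1 (V W : lmodType A) (L : lie_algebroid V) (p : V -> derop W)
    (c : V -> W) : V -> V -> W :=
  fun v1 v2 => p v1 (c v2) - p v2 (c v1) - c (br L v1 v2).

Lemma vfD (X : vfield) f g : X (f + g) = X f + X g.
Proof.
have := vf_lin X 1 f g.
have -> : sf_cst M 1 = 1 :> A by [].
by rewrite !mul1r.
Qed.
Lemma vf0 (X : vfield) : X 0 = 0.
Proof. by apply: (@addrI _ (X 0)); rewrite -vfD !addr0. Qed.
Lemma vfN (X : vfield) f : X (- f) = - X f.
Proof. by apply: (@addrI _ (X f)); rewrite -vfD !subrr vf0. Qed.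
Lemma vf_cst (X : vfield) a : X (sf_cst M a) = 0.
Proof.
have X1 : X 1 = 0.
  by apply: (@addrI _ (X 1)); rewrite addr0 -{3}(mulr1 1) vf_leib mul1r mulr1.
by have := vf_lin X a 1 0; rewrite !addr0 vf0 X1 mulr0 addr0 mulr1.
Qed.
Lemma dopD (W : lmodType A) (d : derop W) u v : d (u + v) = d u + d v.
Proof.
have := dop_lin d 1 u v.
have -> : sf_cst M 1 = 1 :> A by [].
by rewrite !scale1r.
Qed.

Section TrivialRep.
Variables (V : lmodType A) (L : lie_algebroid V).

Fact triv_rep_lin v (a : R) (f g : A^o) :
  anchor L v (sf_cst M a *: f + g) = sf_cst M a *: (anchor L v f : A^o) + anchor L v g.
Proof. exact: vf_lin. Qed.
Fact triv_rep_leib v (f : A) (g : A^o) :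
  anchor L v (f *: g) = f *: (anchor L v g : A^o) + anchor L v f *: g.
Proof. exact: vf_leib. Qed.
Definition triv_rep (v : V) : derop (A^o) :=
  Derop (triv_rep_lin v) (triv_rep_leib v).

Fact ad_lin u (a : R) (v w : V) :
  br L u (sf_cst M a *: v + w) = sf_cst M a *: br L u v + br L u w.
Proof. by rewrite br_skew br_lin opprD -scalerN -!br_skew. Qed.
Definition ad (u : V) : derop V := Derop (ad_lin u) (fun f v => br_leib L f u v).
End TrivialRep.

Section Dual.
Variable V : lmodType A.

Record dual := Dual {
  dualf :> V -> A;
  dual_lin : forall (f : A) (u v : V), dualf (f *: u + v) = f * dualf u + dualf v }.

Lemma dualP (xi eta : dual) : (forall v, xi v = eta v) -> xi = eta.
Proof.
case: xi eta => f hf [g hg] /= /funext fg; case: _ / fg hg => hg.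
by congr Dual; exact: Prop_irrelevance.
Qed.

Lemma dual0 (xi : dual) : xi 0 = 0.
Proof.
by have := dual_lin xi (-1) 0 0; rewrite scaler0 addr0 mulN1r addNr.
Qed.
Lemma dualD (xi : dual) u v : xi (u + v) = xi u + xi v.
Proof. by have := dual_lin xi 1 u v; rewrite scale1r mul1r. Qed.
Lemma dualZ (xi : dual) f v : xi (f *: v) = f * xi v.
Proof. by have := dual_lin xi f v 0; rewrite !addr0 dual0 addr0. Qed.

Lemma dualN (xi : dual) v : xi (- v) = - xi v.
Proof. by rewrite -scaleN1r dualZ mulN1r. Qed.

Fact dual_comb_lin (f : A) (xi eta : dual) g u v :
  f * xi (g *: u + v) + eta (g *: u + v) =
  g * (f * xi u + eta u) + (f * xi v + eta v).
Proof. by rewrite !dual_lin; ring. Qed.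
Fact dual_zero_lin (g : A) (u v : V) : (0 : A) = g * 0 + 0.
Proof. by rewrite mulr0 addr0. Qed.

Definition dual_zero : dual := Dual dual_zero_lin.
Definition dual_comb f xi eta : dual := Dual (dual_comb_lin f xi eta).

HB.instance Definition _ := gen_eqMixin dual.
HB.instance Definition _ := gen_choiceMixin dual.

Fact dual_addA : associative (dual_comb 1).
Proof. by move=> x y z; apply: dualP => v /=; ring. Qed.
Fact dual_addC : commutative (dual_comb 1).
Proof. by move=> x y; apply: dualP => v /=; ring. Qed.
Fact dual_add0 : left_id dual_zero (dual_comb 1).
Proof. by move=> x; apply: dualP => v /=; ring. Qed.
Fact dual_addN : left_inverse dual_zero (dual_comb (-1) ^~ dual_zero) (dual_comb 1).
Proof. by move=> x; apply: dualP => v /=; ring. Qed.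
HB.instance Definition _ :=
  GRing.isZmodule.Build dual dual_addA dual_addC dual_add0 dual_addN.

Let sc f xi := dual_comb f xi dual_zero.
Fact dual_scaleA f g xi : sc f (sc g xi) = sc (f * g) xi.
Proof. by apply: dualP => v /=; ring. Qed.
Fact dual_scale1 : left_id 1 sc.
Proof. by move=> x; apply: dualP => v /=; ring. Qed.
Fact dual_scaleDr : right_distributive sc +%R.
Proof. by move=> f x y; apply: dualP => v /=; ring. Qed.
Fact dual_scaleDl xi : {morph sc^~ xi : f g / f + g}.
Proof. by move=> f g; apply: dualP => v /=; ring. Qed.
HB.instance Definition _ := GRing.Zmodule_isLmodule.Build A dual
  dual_scaleA dual_scale1 dual_scaleDr dual_scaleDl.

Lemma dualDE (xi eta : dual) v : (xi + eta) v = xi v + eta v.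
Proof. by rewrite /GRing.add /= mul1r. Qed.
Lemma dualZE f (xi : dual) v : (f *: xi) v = f * xi v.
Proof. by rewrite /GRing.scale /= addr0. Qed.

End Dual.
Section Bivectors.
Variable V : lmodType A.
Local Notation V' := (dual V).

(* Sections of the second exterior power of V, as skew-symmetric bilinear forms on
   sections of the dual bundle (skew-symmetric is alternating, as 2 is
   invertible). *)
Record bivec := Bivec {
  bivf :> V' -> V' -> A;
  biv_skew : forall xi eta, bivf xi eta = - bivf eta xi;
  biv_lin : forall (f : A) (xi eta zeta : V'),
    bivf (f *: xi + eta) zeta = f * bivf xi zeta + bivf eta zeta }.

Lemma bivP (P Q : bivec) : (forall xi eta, P xi eta = Q xi eta) -> P = Q.
Proof.
case: P Q => f hf kf [g hg kg] /= fg0.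
have fg : f = g by apply/funext => x; apply/funext => y; exact: fg0.
by case: _ / fg hg kg {fg0} => hg kg; congr Bivec; exact: Prop_irrelevance.
Qed.

Lemma bivDl (P : bivec) xi eta zeta : P (xi + eta) zeta = P xi zeta + P eta zeta.
Proof. by have := biv_lin P 1 xi eta zeta; rewrite scale1r mul1r. Qed.
Lemma biv0l (P : bivec) zeta : P 0 zeta = 0.
Proof. by have := biv_lin P (-1) 0 0 zeta; rewrite scaler0 addr0 mulN1r addNr. Qed.
Lemma bivZl (P : bivec) f xi zeta : P (f *: xi) zeta = f * P xi zeta.
Proof. by have := biv_lin P f xi 0 zeta; rewrite biv0l !addr0. Qed.

Fact biv_comb_skew f (P Q : bivec) xi eta :
  f * P xi eta + Q xi eta = - (f * P eta xi + Q eta xi).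
Proof. by rewrite (biv_skew P) (biv_skew Q); ring. Qed.
Fact biv_comb_lin f (P Q : bivec) g xi eta zeta :
  f * P (g *: xi + eta) zeta + Q (g *: xi + eta) zeta =
  g * (f * P xi zeta + Q xi zeta) + (f * P eta zeta + Q eta zeta).
Proof. by rewrite !biv_lin; ring. Qed.
Fact biv_zero_lin (f : A) (xi eta zeta : V') : (0 : A) = f * 0 + 0.
Proof. by rewrite mulr0 addr0. Qed.

Fact biv_zero_skew (xi eta : V') : (0 : A) = - 0.
Proof. by rewrite oppr0. Qed.
Definition biv_zero : bivec := Bivec biv_zero_skew biv_zero_lin.
Definition biv_comb f P Q : bivec := Bivec (biv_comb_skew f P Q) (biv_comb_lin f P Q).

HB.instance Definition _ := gen_eqMixin bivec.
HB.instance Definition _ := gen_choiceMixin bivec.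

Fact biv_addA : associative (biv_comb 1).
Proof. by move=> x y z; apply: bivP => v w /=; ring. Qed.
Fact biv_addC : commutative (biv_comb 1).
Proof. by move=> x y; apply: bivP => v w /=; ring. Qed.
Fact biv_add0 : left_id biv_zero (biv_comb 1).
Proof. by move=> x; apply: bivP => v w /=; ring. Qed.
Fact biv_addN : left_inverse biv_zero (biv_comb (-1) ^~ biv_zero) (biv_comb 1).
Proof. by move=> x; apply: bivP => v w /=; ring. Qed.
HB.instance Definition _ :=
  GRing.isZmodule.Build bivec biv_addA biv_addC biv_add0 biv_addN.

Let sc f P := biv_comb f P biv_zero.
Fact biv_scaleA f g P : sc f (sc g P) = sc (f * g) P.
Proof. by apply: bivP => v w /=; ring. Qed.
Fact biv_scale1 : left_id 1 sc.
Proof. by move=> x; apply: bivP => v w /=; ring. Qed.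
Fact biv_scaleDr : right_distributive sc +%R.
Proof. by move=> f x y; apply: bivP => v w /=; ring. Qed.
Fact biv_scaleDl P : {morph sc^~ P : f g / f + g}.
Proof. by move=> f g; apply: bivP => v w /=; ring. Qed.
HB.instance Definition _ := GRing.Zmodule_isLmodule.Build A bivec
  biv_scaleA biv_scale1 biv_scaleDr biv_scaleDl.

Lemma bivDE (P Q : bivec) xi eta : (P + Q) xi eta = P xi eta + Q xi eta.
Proof. by rewrite /GRing.add /= mul1r. Qed.
Lemma bivZE f (P : bivec) xi eta : (f *: P) xi eta = f * P xi eta.
Proof. by rewrite /GRing.scale /= addr0. Qed.

(* Sections of V, seen in degree 1 of the exterior algebra, are linear forms on
   sections of the dual bundle. *)
Fact ev_lin (u : V) (f : A) (xi eta : V') :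
  (f *: xi + eta) u = f * xi u + eta u.
Proof. by rewrite dualDE dualZE. Qed.
Definition ev (u : V) : dual V' := Dual (ev_lin u).

Fact wedge_skew (P Q : dual V') xi eta :
  P xi * Q eta - P eta * Q xi = - (P eta * Q xi - P xi * Q eta).
Proof. by rewrite opprB. Qed.
Fact wedge_lin (P Q : dual V') f xi eta zeta :
  P (f *: xi + eta) * Q zeta - P zeta * Q (f *: xi + eta) =
  f * (P xi * Q zeta - P zeta * Q xi) + (P eta * Q zeta - P zeta * Q eta).
Proof. by rewrite !dual_lin; ring. Qed.
Definition wedge (P Q : dual V') : bivec := Bivec (wedge_skew P Q) (wedge_lin P Q).

Variable d : derop V.

Fact ddual_lin (xi : V') f u v :
  symb d (xi (f *: u + v)) - xi (d (f *: u + v)) =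
  f * (symb d (xi u) - xi (d u)) + (symb d (xi v) - xi (d v)).
Proof.
rewrite dopD dop_leib !dual_lin !dualD !dualZ vfD vf_leib; ring.
Qed.
Definition ddual (xi : V') : V' := Dual (ddual_lin xi).

Lemma ddual_comb f xi eta :
  ddual (f *: xi + eta) = f *: ddual xi + (symb d f *: xi + ddual eta).
Proof.
apply: dualP => v.
rewrite -[LHS]/(symb d ((f *: xi + eta) v) - (f *: xi + eta) (d v)).
by rewrite !(dualDE, dualZE) /= vfD vf_leib; ring.
Qed.

Fact ext2f_skew (P : bivec) xi eta :
  symb d (P xi eta) - P (ddual xi) eta - P xi (ddual eta) =
  - (symb d (P eta xi) - P (ddual eta) xi - P eta (ddual xi)).
Proof.
rewrite (biv_skew P xi) (biv_skew P (ddual xi)) (biv_skew P xi) vfN; ring.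
Qed.
Fact ext2f_lin (P : bivec) f xi eta zeta :
  symb d (P (f *: xi + eta) zeta) - P (ddual (f *: xi + eta)) zeta
    - P (f *: xi + eta) (ddual zeta) =
  f * (symb d (P xi zeta) - P (ddual xi) zeta - P xi (ddual zeta))
  + (symb d (P eta zeta) - P (ddual eta) zeta - P eta (ddual zeta)).
Proof.
rewrite ddual_comb !biv_lin vfD vf_leib; ring.
Qed.
Definition ext2f (P : bivec) : bivec := Bivec (ext2f_skew P) (ext2f_lin P).

Lemma ext2fE (P : bivec) xi eta :
  ext2f P xi eta = symb d (P xi eta) - P (ddual xi) eta - P xi (ddual eta).
Proof. by []. Qed.

Fact ext2_lin (a : R) (P Q : bivec) :
  ext2f (sf_cst M a *: P + Q) = sf_cst M a *: ext2f P + ext2f Q.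
Proof.
apply: bivP => xi eta.
by rewrite !(bivDE, bivZE, ext2fE) vf_lin; ring.
Qed.
Fact ext2_leib f (P : bivec) : ext2f (f *: P) = f *: ext2f P + symb d f *: P.
Proof.
by apply: bivP => xi eta; rewrite !(bivDE, bivZE, ext2fE) vf_leib; ring.
Qed.
Definition ext2 : derop bivec := Derop ext2_lin ext2_leib.

Lemma ext2_wedge u v :
  ext2 (wedge (ev u) (ev v)) = wedge (ev (d u)) (ev v) + wedge (ev u) (ev (d v)).
Proof.
apply: bivP => xi eta; rewrite !bivDE /= vfD vfN !vf_leib; ring.
Qed.

End Bivectors.

Section Coboundary.
Variables (V : lmodType A) (L : lie_algebroid V) (L' : lie_algebroid (dual V)).

(* The coboundary operator d_* of the Lie algebroid structure L' on the dual, on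
   functions ([dstar0]), on degree 1 ([dstar1]), and on sections of V ([dstar]),
   with values in the cochains of L', i.e. in the exterior powers of V. *)

Fact dstar0_lin (f g : A) (xi eta : dual V) :
  ce0 (triv_rep L') f (g *: xi + eta) =
  g * ce0 (triv_rep L') f xi + ce0 (triv_rep L') f eta.
Proof. exact: anchor_lin. Qed.
Definition dstar0 (f : A) : dual (dual V) := Dual (dstar0_lin f).

Fact dstar1_skew (P : dual (dual V)) xi eta :
  ce1 (W := A^o) L' (triv_rep L') P xi eta =
  - ce1 (W := A^o) L' (triv_rep L') P eta xi.
Proof. by rewrite /ce1 br_skew dualN opprB addrAC; ring. Qed.
Fact dstar1_lin (P : dual (dual V)) f xi eta zeta :
  ce1 (W := A^o) L' (triv_rep L') P (f *: xi + eta) zeta =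
  f * ce1 (W := A^o) L' (triv_rep L') P xi zeta
  + ce1 (W := A^o) L' (triv_rep L') P eta zeta.
Proof.
rewrite /ce1 /= br_comb (dual_lin P f xi) (dual_lin P f) dualD dualN dualZ !anchor_lin vfD vf_leib; ring.
Qed.
Definition dstar1 (P : dual (dual V)) : bivec V :=
  Bivec (dstar1_skew P) (dstar1_lin P).
Definition dstar (u : V) : bivec V := dstar1 (ev u).

(* The Schouten brackets [u, W] and [W, u] = - [u, W] for W a bivector: [u, .] is
   the derivation of the wedge product extending the bracket of V, see
   [ext2_wedge]. *)
Definition schouten12 (u : V) (W : bivec V) : bivec V := ext2 (ad L u) W.
Definition schouten21 (W : bivec V) (u : V) : bivec V := - schouten12 u W.

Definition lie_bialgebroid := forall u v : V,
  dstar (br L u v) = schouten21 (dstar u) v + schouten12 u (dstar v).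

(* d_* = [tau, .] is meant as an equality of maps from sections of V to bivectors.
   If V has rank at least 2 it implies the same equality on functions, since
   d_*(f u) = f d_*u + d_*f /\ u; in rank 1, where bivectors vanish, the equality
   on functions would be the vanishing of the anchor of L'. *)
Definition coboundary_lie_bialgebroid := exists tau : bivec V,
  forall u : V, dstar u = schouten21 tau u.

End Coboundary.

Section Cochains.
Variables (V W : lmodType A) (L : lie_algebroid V) (p : V -> derop W).

Definition is_cocycle (c : V -> W) := forall u v, ce1 L p c u v = 0.
Definition is_coboundary (c : V -> W) := exists w, forall v, c v = ce0 p w v.
End Cochains.

End Algebroids.

Section JetAlgebroid.
Variables (R : realType) (n : nat) (M : manifold R n) (r : nat) (E : vbundle M r).
Local Notation GE := (Gamma (vb_sections E)).
Local Notation GJ := (Gamma (jet_sections E)).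

(* The section df (x) u of Hom(TM, E), inside the jet bundle. *)
Definition dtens (f : smooth_fun M) (u : GE) : GJ := jet (f *: u) - f *: jet u.

Variables (LE : lie_algebroid GE) (LE' : lie_algebroid (dual GE)).

(* Sections of the jet bundle are generated over C^oo(M) by jets of sections of E,
   so each of the following predicates holds of exactly one object. *)
Definition is_adjoint (p : GJ -> derop GE) :=
  derop_linear p /\ forall u v, p (jet u) v = br LE u v.

Definition is_jet_algebroid (p : GJ -> derop GE) (LJ : lie_algebroid GJ) :=
  [/\ forall u v, br LJ (jet u) (jet v) = jet (br LE u v),
      forall u f v, br LJ (jet u) (dtens f v) =
        dtens (anchor LE u f) v + dtens f (br LE u v),
      forall f u g v, br LJ (dtens f u) (dtens g v) =
        anchor LE u g *: dtens f v - anchor LE v f *: dtens g u &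
      forall mu f, anchor LJ mu f = symb (p mu) f].

Definition tensor2 (p : GJ -> derop GE) (mu : GJ) : derop (bivec GE) := ext2 (p mu).

Definition is_dstar_lift (h : {linear GJ -> bivec GE}) :=
  (forall u, h (jet u) = dstar LE' u) /\
  (forall f u, h (dtens f u) = wedge (dstar0 LE' f) (ev u)).
End JetAlgebroid.

(* Main.v *)
Require Import Defs.
From HB Require Import structures.
From mathcomp Require Import all_boot all_order all_algebra.
From mathcomp Require Import ring.
From mathcomp Require Import all_classical all_reals all_analysis.
Set Implicit Arguments. Unset Strict Implicit. Unset Printing Implicit Defensive.
Import Order.TTheory GRing.Theory Num.Theory numFieldNormedType.Exports.
Local Open Scope classical_set_scope.
Local Open Scope ring_scope.

(* On jets of sections, the cocycle condition for [dhat] reads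
   [u, d_* v] - [v, d_* u] = d_* [u, v], the Lie bialgebroid condition, and the
   condition dhat = delta w reads d_* u = [u, w] = [- w, u].  Both conditions are
   C^oo(M)-linear in the sections of the jet bundle, so it is enough that jets
   generate these sections locally: near a point, choose a bump function phi
   supported in a chart domain with coordinates y_i that trivializes E with
   frame e_j.  The sections u_j = phi e_j and functions Y_i = phi y_i are then
   global, and since
     phi d(Y_i) (x) u_j - Y_i dphi (x) u_j = phi^3 dy_i (x) e_j,
     phi jet(u_j) - dphi (x) u_j           = phi^2 jet(e_j)
   (for e_j constant in the frame), phi^4 mu is a combination of global jets for
   every section mu. *)

(** * A flat function *)

Section FlatFunction.
Variable R : realType.
Implicit Types (k : nat) (t : R).

(* The factors 1/t^k close the family under differentiation. *)
Definition flat k t : R := if 0 < t then t^-1 ^+ k * expR (- t^-1) else 0.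

Lemma flat_ge0 k t : 0 <= flat k t.
Proof.
rewrite /flat; case: ifP => // t0.
by rewrite mulr_ge0 ?expR_ge0// exprn_ge0// invr_ge0 ltW.
Qed.

Lemma flatS k t : flat k t = t * flat k.+1 t.
Proof.
rewrite /flat; case: ifP => [t0|_]; last by rewrite mulr0.
by rewrite exprS !mulrA mulfV ?mul1r// gt_eqF.
Qed.

Lemma flat_le k t : flat k t <= (k.+1%:R ^+ k.+1) * `|t|.
Proof.
rewrite /flat; case: ifP => [t0|_]; last by rewrite mulr_ge0// exprn_ge0.
rewrite (gtr0_norm t0); set m := k.+1.
have m0 : 0 < m%:R :> R by rewrite ltr0n.
have h : (t^-1 / m%:R) ^+ m <= expR t^-1.
  have -> : expR t^-1 = expR (t^-1 / m%:R) ^+ m.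
    by rewrite -expRM_natr -mulrA mulVf ?mulr1// gt_eqF.
  rewrite lerXn2r ?nnegrE ?expR_ge0 ?divr_ge0 ?invr_ge0 ?ltW//.
  by apply: lt_le_trans (expR_ge1Dx _); rewrite ltrDr.
rewrite expRN ler_pdivrMr ?expR_gt0//.
have -> : t^-1 ^+ k = m%:R ^+ m * t * (t^-1 / m%:R) ^+ m.
  rewrite expr_div_n (mulrCA _ (t^-1 ^+ m)) /m exprS.
  by rewrite mulrACA mulrA; field; rewrite gt_eqF//=; rewrite gt_eqF// -[1]/(1%:R) -natrD ltr0n.
by rewrite ler_wpM2l// mulr_ge0 ?exprn_ge0// ltW.
Qed.

Lemma flat_cvg0 k : flat k t @[t --> 0] --> (0 : R).
Proof.
apply: (@squeeze_cvgr _ _ _ _ (cst 0) (fun t => k.+1%:R ^+ k.+1 * `|t|)).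
- by near=> t; rewrite flat_ge0 flat_le.
- exact: cvg_cst.
- rewrite -[X in _ --> X](mulr0 (k.+1%:R ^+ k.+1)); apply: cvgMr.
  by rewrite -[X in _ --> X](normr0 R); exact: cvg_norm.
Unshelve. all: by end_near. Qed.

Lemma flat_le0 k t : t <= 0 -> flat k t = 0.
Proof. by rewrite /flat; case: ltgtP. Qed.

Lemma is_derive_flat k t :
  is_derive t 1 (flat k) (- k%:R * flat k.+1 t + flat k.+2 t).
Proof.
have [t0|t0|->] := ltgtP t 0.
- apply: (@near_eq_is_derive _ _ _ (cst 0)).
    by near=> x; rewrite flat_le0// ltW//; near: x; exact: lt_nbhsl.
  by rewrite !flat_le0 ?(ltW t0)// mulr0 addr0; exact: is_derive_cst.
- apply: (@near_eq_is_derive _ _ _ ((fun x : R => x^-1) ^+ k * (fun x : R => expR (- x^-1)))).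
    near=> x; rewrite /flat ifT; last by near: x; exact: lt_nbhsr.
    by rewrite -[LHS]/(((fun x : R => x^-1) ^+ k) x * _) fctE.
  have tn : t != 0 by rewrite gt_eqF.
  have dV : is_derive t 1 (fun x : R => x^-1) (- t ^- 2).
    by have := @is_deriveV _ id t 1 1 tn (is_derive_id _ _); rewrite scaler1.
  have dE : is_derive t 1 (fun x : R => expR (- x^-1)) (expR (- t^-1) * t ^- 2).
    have := @is_derive1_comp _ expR (fun x => - x^-1) t _ _ (is_derive_expR _) (is_deriveN dV).
    by rewrite opprK.
  apply: is_derive_eq; rewrite fctE /flat t0.
  have sE (a b : R) : a *: b = a * b by [].
  rewrite !sE -exprVn; set e := expR _; set s := t^-1.
  by case: k => [|k]; rewrite ?exprS ?expr0 /=; ring.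
- rewrite !(flat_le0 _ (lexx _)) mulr0 addr0.
  have h : h^-1 *: (flat k (h *: 1 + 0) - flat k 0) @[h --> 0^'] --> (0 : R).
    have : flat k.+1 @ 0^' --> (0 : R) by exact: cvg_within_filter (flat_cvg0 k.+1).
    apply: cvg_trans.
    apply: near_eq_cvg; near=> h.
    have h0 : h != 0 by near: h; exact: nbhs_dnbhs_neq.
    have -> : h *: (1 : R) + 0 = h by rewrite addr0; exact: mulr1.
    by rewrite (flat_le0 _ (lexx _)) subr0 (flatS k h); exact/esym/mulKf.
  by split; [apply: cvgP h|apply: cvg_lim h].
Unshelve. all: by end_near. Qed.

Lemma continuous_flat k : continuous (flat k).
Proof.
move=> t; apply/differentiable_continuous/derivable1_diffP.
by have [] := is_derive_flat k t.
Qed.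

End FlatFunction.

(** * Smooth maps between coordinate spaces *)

Section ChainRule.
Variables (R : realType) (n m : nat).
Implicit Types (F : 'rV[R]_n -> 'rV[R]_m) (g : 'rV[R]_m -> R) (y v : 'rV[R]_n).

Lemma differentiable_row F y :
  (forall k, differentiable (fun z => F z 0 k) y) -> differentiable F y.
Proof.
move=> dF; have -> : F = \sum_(k < m) (fun z => F z 0 k *: evec R k).
  by apply/funext => z; rewrite fct_sumE [LHS]row_sum_delta.
by apply: differentiable_sum => k; exact: differentiableZl.
Qed.

Lemma differentiable_comp_row F g y :
  (forall k, differentiable (fun z => F z 0 k) y) -> differentiable g (F y) ->
  differentiable (fun z => g (F z)) y.
Proof. by move=> /differentiable_row dF dg; exact: differentiable_comp. Qed.

Lemma derive_comp_row F g y v :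
  (forall k, differentiable (fun z => F z 0 k) y) -> differentiable g (F y) ->
  'D_v (fun z => g (F z)) y =
  \sum_(k < m) 'D_(evec R k) g (F y) * 'D_v (fun z => F z 0 k) y.
Proof.
move=> dFk dg; have dF := differentiable_row dFk.
rewrite deriveE; last exact: differentiable_comp.
rewrite [in LHS](_ : (fun z => g (F z)) = g \o F)// diff_comp//= [X in 'd g _ X]row_sum_delta.
rewrite linear_sum; apply: eq_bigr => k _; rewrite linearZ /= deriveE// mulrC.
congr (_ * _).
rewrite -deriveE// derive_mx ?mxE//.
exact: diff_derivable.
Qed.

End ChainRule.

Section SmoothOnTheory.
Variables (R : realType) (n : nat).
Implicit Types (U V : set 'rV[R]_n) (f : 'rV[R]_n -> R).

Lemma Ck_sum k U (I : Type) (s : seq I) (f : I -> 'rV[R]_n -> R) : open U ->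
  (forall i, Ck k U (f i)) -> Ck k U (fun x => \sum_(i <- s) f i x).
Proof.
move=> oU hf; elim: s => [|i s IH].
  by apply: (Ck_ext oU _ (Ck_cst k U 0)) => x _; rewrite big_nil.
by apply: (Ck_ext oU _ (CkD oU (hf i) IH)) => x _; rewrite big_cons.
Qed.

Lemma CkU k U V f : Ck k U f -> Ck k V f -> Ck k (U `|` V) f.
Proof.
elim: k f => [|k IH] f /=; first by move=> hU hV x [/hU|/hV].
by move=> [U1 U2] [V1 V2]; split=> [x [/U1|/V1]//|i]; exact: IH.
Qed.

Lemma Ck_comp k m U (W : set 'rV[R]_m) (F : 'rV[R]_n -> 'rV[R]_m) (g : 'rV[R]_m -> R) : open U ->
  (forall y, U y -> W (F y)) ->
  (forall i, smooth_on U (fun y => F y 0 i)) -> smooth_on W g ->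
  Ck k U (fun y => g (F y)).
Proof.
move=> oU UW hF.
have dF y i : U y -> differentiable (fun z => F z 0 i) y by have [+ _] := hF i 1; exact.
elim: k g => [|k IH] g hg.
  move=> y Uy; apply: (@differentiable_continuous _ _ _ y (fun z => g (F z))).
  apply: differentiable_comp_row => [i|]; first exact: dF.
  by have [+ _] := hg 1; apply; exact: UW.
have dg z : W z -> differentiable g z by have [+ _] := hg 1; exact.
split=> [y Uy|i].
  by apply: differentiable_comp_row => [i|]; [exact: dF|exact/dg/UW].
have h : Ck k U (fun y => \sum_(j <- enum 'I_m)
    'D_(evec R j) g (F y) * 'D_(evec R i) (fun z => F z 0 j) y).
  apply: Ck_sum => // j; apply: CkM => //; last by have [_] := hF j k.+1; exact.
  apply: (IH (fun x => 'D_(evec R j) g x)) => l.  by have [_] := hg l.+1; exact.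
apply: (Ck_ext oU _ h) => y; rewrite inE => Uy.
by rewrite derive_comp_row ?big_enum// => [j|]; [exact: dF|exact/dg/UW].
Qed.

Lemma derive_coord (i j : 'I_n) (y : 'rV[R]_n) :
  'D_(evec R j) (fun z : 'rV[R]_n => z 0 i) y = (i == j)%:R.
Proof.
have d : derivable (id : 'rV[R]_n -> 'rV[R]_n) y (evec R j) by exact: derivable_id.
have /matrixP /(_ 0 i) := derive_mx d.
by rewrite mxE derive_id mxE eqxx eq_sym => ->.
Qed.

Lemma smooth_on_coord U (i : 'I_n) : smooth_on U (fun y => y 0 i).
Proof.
case=> [|k]; first by move=> y _; exact/differentiable_continuous/differentiable_coord.
split=> [y _|j]; first exact: differentiable_coord.
have -> : (fun x : 'rV[R]_n => 'D_(evec R j) (fun y : 'rV[R]_n => y 0 i) x) = fun=> (i == j)%:R.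
  by apply/funext => y; rewrite derive_coord.
exact: Ck_cst.
Qed.

Lemma smooth_on_flat U (q : 'rV[R]_n -> R) : open U -> smooth_on U q ->
  smooth_on U (fun y => flat 0 (q y)).
Proof.
move=> oU hq k.
suff: forall j, Ck k U (fun y => flat j (q y)) by exact.
elim: k => [|k IH] j.
  move=> y Uy; apply: (@continuous_comp _ _ _ (q : 'rV[R]_n -> R) (flat j) y); first exact: (hq 0%N y Uy).
  exact: continuous_flat.
have dq y : U y -> differentiable q y by have [+ _] := hq 1; exact.
have df t : differentiable (flat j) t.
  by apply/derivable1_diffP; have [] := is_derive_flat j t.
have dfq y : U y -> differentiable (flat j \o q) y.
  by move=> Uy; apply: differentiable_comp => //; exact: dq.
split=> [y Uy|i]; first exact: dfq.
have h : Ck k U (fun y => (- j%:R * flat j.+1 (q y) + flat j.+2 (q y)) *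
    'D_(evec R i) q y).
  apply: CkM => //; last by have [_] := hq k.+1; exact.
  by apply: CkD => //; apply: CkM => //; exact: Ck_cst.
apply: (Ck_ext oU _ h) => y; rewrite inE => Uy.
rewrite [RHS]deriveE; last exact: dfq.
rewrite diff_comp//=; last exact: dq.
rewrite -(deriveE _ (dq _ Uy)) diff1E// derive1E.
by have [_ ->] := is_derive_flat j (q y); rewrite mulrC.
Qed.

End SmoothOnTheory.

(** * Bump functions on a manifold *)

Section SmoothIn.
Variables (R : realType) (n : nat) (M : manifold R n).
Implicit Types (c d : chart R n M) (V W K : set M) (f : M -> R).

Lemma smooth_in_chart c d V f : atlas c -> atlas d -> open V -> V `<=` cdom c ->
  smooth_in c V f -> smooth_in d V f.
Proof.
move=> ac ad oV Vc sf k.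
have [_ _ cK _ _] := atlas_chart ac; have [_ _ dK _ _] := atlas_chart ad.
have oi := open_chart_img ad oV.
have h : Ck k (chart_img d V) (fun y => (f \o cinv c) (cmap c (cinv d y))).
  apply: (Ck_comp (F := fun y => cmap c (cinv d y)) k oi _ _ sf).
    move=> _ [x [dx Vx] <-]; rewrite dK//; exists x => //; split=> //; exact: Vc.
  move=> i l; apply: Ck_sub (atlas_compat ad ac i l) => _ [x [dx Vx] <-].
  by exists x => //; split=> //; exact: Vc.
apply: (Ck_ext oi _ h) => y; rewrite inE => -[x [dx Vx] <-] /=.
by rewrite dK// cK//; exact: Vc.
Qed.

Lemma smooth_inU c V W f : smooth_in c V f -> smooth_in c W f -> smooth_in c (V `|` W) f.
Proof.
move=> hV hW k; apply: Ck_sub (CkU (hV k) (hW k)) => _ [x [cx [Vx|Wx]] <-].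
  by left; exists x.
by right; exists x.
Qed.

Lemma smooth_in_support c V K W f : atlas c -> open V -> closed K -> K `<=` V ->
  (forall x, W x -> ~ K x -> f x = 0) -> open W -> smooth_in c (W `&` V) f -> smooth_in c W f.
Proof.
move=> ac oV cK KV f0 oW sf.
have h : smooth_in c (W `&` ~` K) f.
  apply: (smooth_in_ext ac _ _ (@smooth_in_cst _ _ _ c _ 0)).
    by apply: openI => //; exact: closed_openC.
  by move=> x; rewrite inE => -[Wx Kx]; rewrite f0.
apply: smooth_in_sub (smooth_inU sf h) => x Wx.
by have [Kx|nKx] := pselect (K x); [left; split=> //; exact: KV|right].
Qed.

Lemma smooth_bump c V x0 : atlas c -> open V -> V `<=` cdom c -> V x0 ->
  exists (phi : smooth_fun M) K, [/\ closed K, K `<=` V,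
    forall x, ~ K x -> phi x = 0 & phi x0 != 0].
Proof.
move=> ac oV Vc Vx0; have [_ oi cK _ ci] := atlas_chart ac.
set y0 := cmap c x0.
have [e e0 eV] : exists2 e : R, 0 < e & ball y0 e `<=` chart_img c V.
  apply/nbhs_ballP; have : chart_img c V y0 by exists x0 => //; split=> //; exact: Vc.
  by move: (open_chart_img ac oV); rewrite openE; apply.
pose r := e / 2; have r0 : 0 < r by rewrite divr_gt0.
pose B := [set y : 'rV[R]_n | forall i, `[y0 0 i - r, y0 0 i + r]%classic (y 0 i)].
have BE y : B y <-> forall i, `|y 0 i - y0 0 i| <= r.
  by split=> h i; have := h i; rewrite /= in_itv /= ler_distl.
have BV : B `<=` chart_img c V.
  move=> y /BE By; apply: eV; split=> // i j; rewrite ord1 /ball /= distrC.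
  by apply: le_lt_trans (By j) _; rewrite /r ltr_pdivrMr// ltr_pMr// ltr1n.
have cB : compact B.
  apply: (@rV_compact _ _ (fun i => `[y0 0 i - r, y0 0 i + r]%classic)) => i.
  exact: segment_compact.
pose K := cinv c @` B.
have BK y : B y -> exists2 x, V x & [/\ cdom c x, cmap c x = y & cinv c y = x].
  by move=> /BV [x [cx Vx] <-]; exists x => //; rewrite cK.
have clK : closed K.
  apply: compact_closed; first exact: mfd_hausdorff.
  apply: continuous_compact cB; apply: continuous_in_subspaceT => y.
  by rewrite inE => /BV [x [cx _] <-]; apply: ci; exists x.
have KV : K `<=` V by move=> _ [y /BK [x Vx [_ _ ->]] <-].
pose q (y : 'rV[R]_n) := r ^+ 2 + -1 * \sum_(i < n) (y 0 i + - y0 0 i) * (y 0 i + - y0 0 i).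
pose f x := if `[< V x >] then flat 0 (q (cmap c x)) else 0.
have f0 x : ~ K x -> f x = 0.
  rewrite /f; case: asboolP => // Vx nK; apply: flat_le0.
  rewrite /q mulN1r subr_le0 leNgt; apply/negP => h; apply: nK.
  exists (cmap c x); last by rewrite cK//; exact: Vc.
  apply/BE => i; rewrite -(@ler_pXn2r _ 2) ?nnegrE ?(ltW r0)//.
  apply: (le_trans _ (ltW h)); rewrite (bigD1 i)//= -expr2 real_normK ?num_real//.
  by rewrite lerDl sumr_ge0// => j _; rewrite -expr2 sqr_ge0.
have sq U : open U -> smooth_on U q.
  move=> oU k; apply: CkD => //; first exact: Ck_cst.
  apply: CkM => //; first exact: Ck_cst.
  have h i : Ck k U (fun y : 'rV[R]_n => y 0 i + - y0 0 i).
    by apply: CkD => //; [exact: smooth_on_coord|exact: Ck_cst].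
  by apply: Ck_sum => // i; apply: CkM.
have sf d : atlas d -> smooth_in d setT f.
  move=> ad; apply: (smooth_in_support ad oV clK KV (fun x _ => f0 x) openT).
  rewrite setTI; apply: (smooth_in_chart ac ad oV Vc).
  have oV' := open_chart_img ac oV.
  move=> k; apply: (Ck_ext oV' _ (smooth_on_flat oV' (sq _ oV') k)) => _ /[!inE] -[x [cx Vx] <-].
  by rewrite /f /= cK// asboolT.
exists (SmoothFun sf), K; split=> //=.
rewrite /f asboolT// /q big1 => [|i _]; last by rewrite subrr mul0r.
by rewrite mulr0 addr0 /flat exprn_gt0// expr0 mul1r gt_eqF// expR_gt0.
Qed.

End SmoothIn.

(** * Partial derivatives in a chart and cut-off frames *)

Section PartialDerivatives.
Variables (R : realType) (n : nat) (M : manifold R n).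
Implicit Types (c d : chart R n M) (V : set M) (f g : M -> R) (x : M).

Definition pd c (i : 'I_n) f x : R := 'D_(evec R i) (f \o cinv c) (cmap c x).

Lemma smooth_in_differentiable c V f x : V x -> cdom c x -> smooth_in c V f ->
  differentiable (f \o cinv c) (cmap c x).
Proof. by move=> Vx cx /(_ 1%N)[+ _]; apply; exists x. Qed.

Lemma smooth_in_derivable c V f x i : V x -> cdom c x -> smooth_in c V f ->
  derivable (f \o cinv c) (cmap c x) (evec R i).
Proof. by move=> Vx cx sf; exact/diff_derivable/(smooth_in_differentiable Vx). Qed.

Lemma pd_ext c V f g i x : atlas c -> open V -> V x -> cdom c x -> {in V, f =1 g} ->
  pd c i f x = pd c i g x.
Proof.
move=> ac oV Vx cx fg; have [_ _ cK _ _] := atlas_chart ac.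
apply: near_eq_derive.
apply: (open_near_eq (open_chart_img ac oV)); last by exists x.
by move=> _ /[!inE] -[z [cz Vz] <-] /=; rewrite cK// fg// inE.
Qed.

Lemma pdM c V f g i x : atlas c -> V x -> cdom c x -> smooth_in c V f -> smooth_in c V g ->
  pd c i (fun z => f z * g z) x = f x * pd c i g x + pd c i f x * g x.
Proof.
move=> ac Vx cx sf sg; have [_ _ cK _ _] := atlas_chart ac.
have := deriveM (smooth_in_derivable (i := i) Vx cx sf) (smooth_in_derivable Vx cx sg).
by rewrite /= cK// /pd => ->; rewrite [X in _ + X]mulrC.
Qed.

Lemma pd_cst c a i x : pd c i (fun=> a) x = 0.
Proof. exact: derive_cst. Qed.

Lemma pd_coord c i j x : atlas c -> cdom c x ->
  pd c i (fun z => cmap c z 0 j) x = (j == i)%:R.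
Proof.
move=> ac cx; have [oc _ cK _ _] := atlas_chart ac.
rewrite -(derive_coord j i (cmap c x)); apply: near_eq_derive.
apply: (open_near_eq (open_chart_img ac oc)); last by exists x.
by move=> _ /[!inE] -[z [cz _] <-] /=; rewrite cK.
Qed.

Lemma pd_chart c d V f i x : atlas c -> atlas d -> open V -> V `<=` cdom c ->
  V x -> cdom d x -> smooth_in c V f ->
  pd d i f x = \sum_(l < n) pd c l f x * pd d i (fun z => cmap c z 0 l) x.
Proof.
move=> ac ad oV Vc Vx dx sf; have [_ _ cK _ _] := atlas_chart ac.
have [_ _ dK _ _] := atlas_chart ad.
have -> : pd d i f x = pd d i (fun z => (f \o cinv c) (cmap c z)) x.
  apply: (pd_ext _ ad oV Vx dx) => z; rewrite inE => Vz /=; rewrite cK//; exact: Vc.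
rewrite /pd (@derive_comp_row _ _ _ (cmap c \o cinv d) (f \o cinv c))/= ?dK//.
  move=> k; have [+ _] := atlas_compat ad ac k 1; apply.
  by exists x => //; split=> //; exact: Vc.
exact: smooth_in_differentiable Vx (Vc _ Vx) sf.
Qed.

End PartialDerivatives.

Section Trivializations.
Variables (R : realType) (n : nat) (M : manifold R n) (r : nat) (E : vbundle M r).

Lemma tmap0 (t : ltriv E r) x : trivs t -> tdom t x -> tmap t (0 : E x) = 0.
Proof.
move=> ht tx; have := triv_linear ht tx (-1) 0 0.
by rewrite scaler0 addr0 scaleN1r addNr.
Qed.

Lemma tmapZ (t : ltriv E r) x a (v : E x) : trivs t -> tdom t x ->
  tmap t (a *: v) = a *: tmap t v.
Proof. by move=> ht tx; rewrite -[a *: v]addr0 triv_linear// tmap0// addr0. Qed.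

Lemma tmap_sum (t : ltriv E r) x (I : Type) (s : seq I) (v : I -> E x) :
  trivs t -> tdom t x -> tmap t (\sum_(i <- s) v i) = \sum_(i <- s) tmap t (v i).
Proof.
move=> ht tx; elim: s => [|i s IH]; first by rewrite !big_nil tmap0.
by rewrite !big_cons -[v i]scale1r triv_linear// IH !scale1r.
Qed.

Lemma tinv_frame (t : ltriv E r) x (w : E x) : trivs t -> tdom t x ->
  w = \sum_(i < r) tmap t w 0 i *: tinv t x (delta_mx 0 i).
Proof.
move=> ht tx; apply: (can_inj (triv_mapK ht tx)); rewrite tmap_sum// [LHS]row_sum_delta.
by apply: eq_bigr => i _; rewrite tmapZ// triv_invK.
Qed.

End Trivializations.

Section Cutoff.
Variables (R : realType) (n : nat) (M : manifold R n) (r : nat) (E : vbundle M r).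
Variables (V K : set M) (phi : smooth_fun M).
Hypotheses (oV : open V) (clK : closed K) (KV : K `<=` V).
Hypothesis phi0 : forall x, ~ K x -> phi x = 0.

Lemma cutoff_fun c (g : M -> R) : atlas c -> V `<=` cdom c -> smooth_in c V g ->
  exists f : smooth_fun M, forall x, f x = phi x * g x.
Proof.
move=> ac Vc sg.
have sf d : atlas d -> smooth_in d setT (fun x => phi x * g x).
  move=> ad; apply: (smooth_in_support ad oV clK KV _ openT) => [x _ /phi0 ->|].
    by rewrite mul0r.
  rewrite setTI; apply: smooth_inM => //; last exact: (smooth_in_chart ac).
  exact: smooth_in_sub (sfun_smooth phi ad).
by exists (SmoothFun sf).
Qed.

Lemma cutoff_frame (t : ltriv E r) (j : 'I_r) : trivs t -> V `<=` tdom t ->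
  exists u : Gamma (vb_sections E), forall x, u x = phi x *: tinv t x (delta_mx 0 j).
Proof.
move=> ht Vt.
have su : vb_smooth (fun x => phi x *: tinv t x (delta_mx 0 j)).
  move=> s d k hs ad; have os := triv_open hs.
  apply: (smooth_in_support ad oV clK KV _ os) => [x sx /phi0 ->|].
    by rewrite scale0r tmap0// mxE.
  have oW : open (tdom s `&` V) by exact: openI.
  apply: (smooth_in_ext ad oW _ (smooth_inM ad oW
    (smooth_in_sub (@subsetT _ _) (sfun_smooth phi ad))
    (smooth_in_sub _ (triv_compat ht hs j k ad)))).
    by move=> x /[!inE] -[sx Vx]; rewrite tmapZ// mxE.
  by move=> x [sx /Vt tx].
by exists (GammaSec (F := vb_sections E) su).
Qed.

End Cutoff.

(** * Coordinates on the jet bundle *)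

Section JetCoordinates.
Variables (R : realType) (n : nat) (M : manifold R n) (r : nat) (E : vbundle M r).
Local Notation GE := (Gamma (vb_sections E)).
Local Notation GJ := (Gamma (jet_sections E)).
Implicit Types (c d : chart R n M) (t s : ltriv E r) (x : M).

Lemma jet1E c t x (u : GE) : atlas c -> trivs t -> cdom c x -> tdom t x ->
  jet1 u x c t = (tmap t (u x), \matrix_(i, j) pd c i (fun z => tmap t (u z) 0 j) x).
Proof. by move=> ac ht cx tx; rewrite /jet1 asboolT. Qed.

Lemma jet1_eq0 c t x (w : GE) : atlas c -> trivs t -> cdom c x -> tdom t x ->
  jet1 w x c t = 0 -> jet1 w x = 0.
Proof.
move=> ac ht cx tx; rewrite jet1E// => -[w0 dw0].
apply/funext => d; apply/funext => s; rewrite [RHS]/(0 : _ * _).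
have [[ad hs dx sx]|h] := pselect [/\ atlas d, trivs s, cdom d x & tdom s x]; last first.
  by rewrite /jet1 asboolF.
rewrite jet1E//; have [oc _ _ _ _] := atlas_chart ac.
pose V := cdom c `&` (tdom t `&` tdom s).
have oV : open V by apply: openI => //; apply: openI; exact: triv_open.
have Vx : V x by [].
have Vc : V `<=` cdom c by move=> z [].
have -> : tmap s (w x) = 0.
  by rewrite (tinv_frame (w x) ht tx) w0 big1 ?tmap0// => i _; rewrite mxE scale0r.
congr pair; apply/matrixP => i j; rewrite !mxE.
pose a k z := tmap t (w z) 0 k; pose b k z := tmap s (tinv t z (delta_mx 0 k)) 0 j.
have sa k e : atlas e -> smooth_in e V (a k).
  move=> ae; apply: smooth_in_sub (@sval_smooth _ _ _ _ w t e k ht ae).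
  by move=> z [_ []].
have sb k e : atlas e -> smooth_in e V (b k).
  move=> ae; apply: smooth_in_sub (triv_compat ht hs k j ae).
  by move=> z [].
have da k : pd d i (a k) x = 0.
  rewrite (pd_chart _ ac ad oV Vc Vx dx (sa k _ ac)) big1// => l _.
  by move/matrixP: dw0 => /(_ l k); rewrite !mxE => ->; rewrite mul0r.
have -> : pd d i (fun z => tmap s (w z) 0 j) x =
    pd d i (fun z => \sum_(k < r) a k z * b k z) x.
  apply: (pd_ext _ ad oV Vx dx) => z; rewrite inE => -[_ [tz sz]].
  rewrite {1}(tinv_frame (w z) ht tz) tmap_sum// summxE.
  by apply: eq_bigr => k _; rewrite tmapZ// mxE.
have dab k : derivable ((fun z => a k z * b k z) \o cinv d) (cmap d x) (evec R i).
  by apply: (smooth_in_derivable Vx dx); apply: smooth_inM; [| |exact: sa|exact: sb].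
rewrite /pd (_ : _ \o _ = \sum_(k < r) ((fun z => a k z * b k z) \o cinv d)); last first.
  by apply/funext => y; rewrite fct_sumE.
rewrite derive_sum// big1// => k _.
rewrite [LHS](pdM _ ad Vx dx (sa k _ ad) (sb k _ ad)) da mul0r addr0.
by rewrite /a w0 mxE mul0r.
Qed.

Lemma jet_section_eq0 c t x (mu : GJ) : atlas c -> trivs t -> cdom c x -> tdom t x ->
  mu x c t = 0 -> mu x = 0.
Proof.
have [w ->] := (sval_smooth mu).1 x.
exact: jet1_eq0.
Qed.

End JetCoordinates.

(** * Local generation by jets *)

Section JetGeneration.
Variables (R : realType) (n : nat) (M : manifold R n) (r : nat) (E : vbundle M r).
Local Notation GE := (Gamma (vb_sections E)).
Local Notation GJ := (Gamma (jet_sections E)).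
Implicit Types (c : chart R n M) (t : ltriv E r) (x : M) (f g phi : smooth_fun M)
  (mu nu : GJ).

Lemma local_data x0 : exists c t (V K : set M) phi,
  [/\ [/\ atlas c, trivs t, open V & V x0], V `<=` cdom c, V `<=` tdom t &
    [/\ closed K, K `<=` V, forall x, ~ K x -> phi x = 0 & phi x0 != 0]].
Proof.
have [c ac cx0] := atlas_cover x0; have [t ht tx0] := @triv_cover _ _ _ _ E x0.
have [oc _ _ _ _] := atlas_chart ac.
have oV : open (cdom c `&` tdom t) by apply: openI => //; exact: triv_open.
have Vc : cdom c `&` tdom t `<=` cdom c by move=> z [].
have [phi [K hK]] := smooth_bump ac oV Vc (conj cx0 tx0).
by exists c, t, (cdom c `&` tdom t), K, phi; split=> // z [].
Qed.

Lemma nonvanishing_section x0 : (0 < r)%N -> exists u : GE, u x0 != 0.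
Proof.
move=> r0; have [c [t [V [K [phi]]]]] := local_data x0.
move=> [[ac ht oV Vx0] Vc Vt [clK KV phi0 phix0]].
have [u uE] := cutoff_frame oV clK KV phi0 (Ordinal r0) ht Vt.
exists u; apply/eqP => ux0.
have /rowP /(_ (Ordinal r0)) := congr1 (@tmap _ _ _ _ t x0) ux0.
rewrite uE tmap0 ?tmapZ ?triv_invK; try exact: Vt; try by [].
by rewrite !mxE !eqxx mulr1 => /eqP; rewrite (negbTE phix0).
Qed.

Let ev c t x (mu : GJ) : 'rV[R]_r * 'M[R]_(n, r) := mu x c t.

Let ev_sum c t x (I : Type) (s : seq I) (F : I -> GJ) :
  ev c t x (\sum_(i <- s) F i) = \sum_(i <- s) ev c t x (F i).
Proof. exact: (big_morph (ev c t x)). Qed.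

Let evZ c t x f mu : ev c t x (f *: mu) = f x *: ev c t x mu.
Proof. by []. Qed.

Let evD c t x mu nu : ev c t x (mu + nu) = ev c t x mu + ev c t x nu.
Proof. by []. Qed.

Let evB c t x mu nu : ev c t x (mu - nu) = ev c t x mu - ev c t x nu.
Proof. by rewrite -[- nu]scaleN1r evD evZ Defs.sfunN Defs.sfun1 scaleN1r. Qed.

Lemma dtensE c t x g (u : GE) : atlas c -> trivs t -> cdom c x -> tdom t x ->
  dtens g u x c t = (0, \matrix_(i, j) (pd c i g x * tmap t (u x) 0 j)).
Proof.
move=> ac ht cx tx; have evjet (v : GE) : ev c t x (jet v) =
    (tmap t (v x), \matrix_(i, j) pd c i (fun z => tmap t (v z) 0 j) x).
  exact: jet1E.
rewrite [LHS](evB c t x) evZ !evjet.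
have ot := triv_open ht; have [oc _ _ _ _] := atlas_chart ac.
have tZ z : tdom t z -> tmap t ((g *: u) z) = g z *: tmap t (u z) by exact: tmapZ.
apply: injective_projections; first by rewrite [LHS]/= tZ// subrr.
apply/matrixP => i j; rewrite [LHS]/= !mxE.
rewrite (pd_ext _ ac ot tx cx (g := fun z => g z * tmap t (u z) 0 j)); last first.
  by move=> z /[!inE] tz; rewrite tZ// mxE.
have su : smooth_in c (tdom t) (fun z => tmap t (u z) 0 j).
  exact: (@sval_smooth _ _ _ _ u t c j ht ac).
rewrite (pdM _ ac tx cx _ su); last exact: smooth_in_sub (@subsetT _ _) (sfun_smooth g ac).
by rewrite addrAC subrr add0r.
Qed.

Lemma jets_generate_locally x0 : exists f, f x0 != 0 /\
  forall P : GJ -> Prop, P 0 -> (forall g mu nu, P mu -> P nu -> P (g *: mu + nu)) ->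
  (forall u, P (jet u)) -> forall mu, P (f *: mu).
Proof.
have [c [t [V [K [phi]]]]] := local_data x0.
move=> [[ac ht oV Vx0] Vc Vt [clK KV phi0 phix0]].
have [oc _ cK _ _] := atlas_chart ac.
have sy i : smooth_in c V (fun z => cmap c z 0 i).
  move=> k; apply: (Ck_ext (open_chart_img ac oV) _ (smooth_on_coord _ i k)).
  by move=> _ /[!inE] -[x [cx Vx] <-] /=; rewrite cK.
pose u j := sval (cid (cutoff_frame oV clK KV phi0 j ht Vt)).
have uE j x : u j x = phi x *: tinv t x (delta_mx 0 j).
  by rewrite /u; case: cid.
pose Y i := sval (cid (cutoff_fun oV clK KV phi0 ac Vc (sy i))).
have YE i x : Y i x = phi x * cmap c x 0 i by rewrite /Y; case: cid.
exists (phi ^+ 4); split; first by rewrite !exprS expr0 !Defs.sfunM !mulf_neq0 ?Defs.sfun1 ?oner_eq0.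
move=> P P0 Pcomb Pjet mu.
have PD mu1 mu2 : P mu1 -> P mu2 -> P (mu1 + mu2).
  by move=> h1 h2; rewrite -[mu1]scale1r; exact: Pcomb.
have PZ g mu1 : P mu1 -> P (g *: mu1) by move=> h; rewrite -[_ *: _]addr0; exact: Pcomb.
have PB mu1 mu2 : P mu1 -> P mu2 -> P (mu1 - mu2).
  by move=> h1 h2; rewrite -scaleN1r; apply: PD => //; exact: PZ.
have Psum (I : Type) (s : seq I) F : (forall i : I, P (F i)) -> P (\sum_(i <- s) F i).
  by move=> PF; elim/big_ind: _.
have Pdtens g v : P (dtens g v) by apply: PB => //; exact: PZ.
have [_ /(_ c t ac ht) [sm0 sm1]] := sval_smooth mu.
have sm0V j : smooth_in c V (fun x => (mu x c t).1 0 j) by exact: smooth_in_sub (sm0 j).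
have sm1V i j : smooth_in c V (fun x => (mu x c t).2 i j) by exact: smooth_in_sub (sm1 i j).
pose a j := sval (cid (cutoff_fun oV clK KV phi0 ac Vc (sm0V j))).
have aE j x : a j x = phi x * (mu x c t).1 0 j by rewrite /a; case: cid.
pose b i j := sval (cid (cutoff_fun oV clK KV phi0 ac Vc (sm1V i j))).
have bE i j x : b i j x = phi x * (mu x c t).2 i j by rewrite /b; case: cid.
pose rhs := \sum_(j < r) ((phi * phi * a j) *: jet (u j) - (phi * a j) *: dtens phi (u j))
  + \sum_(j < r) \sum_(i < n) b i j *: (phi *: dtens (Y i) (u j) - Y i *: dtens phi (u j)).
suff -> : phi ^+ 4 *: mu = rhs.
  apply: PD; apply: (Psum) => j; first by apply: PB; exact: PZ.
  by apply: Psum => i; apply: (PZ); apply: PB; exact: PZ.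
apply/eqP; rewrite -subr_eq0; apply/eqP; apply: GammaP => x.
have [Vx|nVx] := pselect (V x); last first.
  have p0 : phi x = 0 by exact: (phi0 x (fun Kx => nVx (KV x Kx))).
  apply/funext => d; apply/funext => s; rewrite [LHS](evB d s x) /rhs evD !ev_sum evZ.
  have -> : (phi ^+ 4) x = 0 by rewrite exprS Defs.sfunM p0 mul0r.
  rewrite scale0r !big1 ?addr0 ?subr0// => j _; last first.
    by rewrite evB !evZ !Defs.sfunM p0 !mul0r !scale0r subrr.
  by rewrite ev_sum big1// => i _; rewrite evZ bE p0 mul0r scale0r.
have cx := Vc _ Vx; have tx := Vt _ Vx.
apply: (jet_section_eq0 ac ht cx tx).
rewrite [LHS](evB c t x) /rhs evD !ev_sum evZ; apply/eqP; rewrite subr_eq0; apply/eqP.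
have pdY i k : pd c k (Y i) x = phi x * (i == k)%:R + pd c k phi x * cmap c x 0 i.
  rewrite (pd_ext _ ac oV Vx cx (g := fun z => phi z * cmap c z 0 i)) => [|z _]; last exact: YE.
  rewrite (pdM _ ac Vx cx _ (sy i)) ?pd_coord//.
  exact: smooth_in_sub (@subsetT _ _) (sfun_smooth phi ac).
have tu j l z : V z -> tmap t (u j z) 0 l = phi z * (j == l)%:R.
  by move=> Vz; rewrite uE tmapZ ?triv_invK// ?mxE ?eqxx 1?eq_sym//; exact: (Vt z Vz).
have ej j : ev c t x (jet (u j)) =
    (\row_(l < r) (phi x * (j == l)%:R), \matrix_(k < n, l < r) (pd c k phi x * (j == l)%:R)).
  rewrite [LHS]jet1E//; apply: injective_projections => /=.
    by apply/rowP => l; rewrite tu// mxE.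
  apply/matrixP => k l; rewrite !mxE.
  rewrite (pd_ext _ ac oV Vx cx (g := fun z => phi z * (j == l)%:R)); last first.
    by move=> z; rewrite inE => Vz; rewrite tu.
  rewrite (@pdM _ _ _ _ V) ?pd_cst ?mulr0 ?add0r//.
    exact: smooth_in_sub (@subsetT _ _) (sfun_smooth phi ac).
  exact: smooth_in_cst.
have ed g j : ev c t x (dtens g (u j)) =
    (0, \matrix_(k < n, l < r) (pd c k g x * (phi x * (j == l)%:R))).
  rewrite [LHS]dtensE//; congr pair; apply/matrixP => k l; rewrite !mxE tu//.
set m := mu x c t in aE bE *.
have p4 : (phi ^+ 4) x = phi x ^+ 4 by rewrite !exprS !expr0 !Defs.sfunM.
have term0 j : ev c t x ((phi * phi * a j) *: jet (u j) - (phi * a j) *: dtens phi (u j)) =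
    (phi x ^+ 4 * m.1 0 j) *: (delta_mx 0 j, 0).
  rewrite evB !evZ ej ed !Defs.sfunM aE; apply: injective_projections => /=.
    apply/rowP => l; rewrite !mxE eqxx (eq_sym l); ring.
  by apply/matrixP => k l; rewrite !mxE; ring.
have term1 i j : ev c t x (b i j *: (phi *: dtens (Y i) (u j) - Y i *: dtens phi (u j))) =
    (phi x ^+ 4 * m.2 i j) *: (0, delta_mx i j).
  rewrite evZ evB !evZ !ed YE bE; apply: injective_projections => /=.
    by apply/rowP => l; rewrite !mxE; ring.
  apply/matrixP => k l; rewrite !mxE pdY (eq_sym k) (eq_sym l) -mulnb natrM; ring.
rewrite p4 (eq_bigr _ (fun j _ => term0 j)).
under [X in _ + X]eq_bigr => j _ do rewrite ev_sum (eq_bigr _ (fun i _ => term1 i j)).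
have fstS (I : Type) (s : seq I) (F : I -> 'rV[R]_r * 'M[R]_(n, r)) :
    (\sum_(i <- s) F i).1 = \sum_(i <- s) (F i).1 by exact: (big_morph fst).
have sndS (I : Type) (s : seq I) (F : I -> 'rV[R]_r * 'M[R]_(n, r)) :
    (\sum_(i <- s) F i).2 = \sum_(i <- s) (F i).2 by exact: (big_morph snd).
apply: injective_projections; rewrite [RHS]/= !(fstS, sndS) [LHS]/=.
  rewrite [X in _ + X]big1 => [|j _]; last first.
    by rewrite fstS big1// => i _ /=; rewrite scaler0.
  by rewrite addr0 {1}[m.1]row_sum_delta scaler_sumr; under eq_bigr do rewrite scalerA.
rewrite big1 ?add0r => [|j _ /=]; last by rewrite scaler0.
rewrite {1}[m.2]matrix_sum_delta exchange_big scaler_sumr; apply: eq_bigr => j _.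
by rewrite sndS scaler_sumr; apply: eq_bigr => i _; rewrite scalerA.
Qed.

End JetGeneration.

(** * Tensorial maps on the jet algebroid *)

Section LinearMapsOnJets.
Variables (R : realType) (n : nat) (M : manifold R n) (r : nat) (E : vbundle M r).
Local Notation GE := (Gamma (vb_sections E)).
Local Notation GJ := (Gamma (jet_sections E)).

Lemma linear_jet_eq0 (B : GJ -> bivec GE) :
  (forall f mu nu, B (f *: mu + nu) = f *: B mu + B nu) ->
  (forall u, B (jet u) = 0) -> forall mu, B mu = 0.
Proof.
move=> Blin Bjet mu.
have B0 : B 0 = 0.
  by have := Blin (-1) 0 0; rewrite scaler0 addr0 scaleN1r addNr.
apply: bivP => xi eta; apply: smooth_funP => x.
have [f [fx0 gen]] := jets_generate_locally E x.
have Bfmu : B (f *: mu) = 0.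
  apply: (gen (fun nu => B nu = 0)) => // g m1 m2 h1 h2.
  by rewrite Blin h1 h2 scaler0 addr0.
have : f *: B mu = 0 by rewrite -Bfmu -[f *: mu]addr0 Blin B0 addr0.
move=> /(congr1 (fun P : bivec GE => P xi eta x)); rewrite bivZE Defs.sfunM => /eqP.
by rewrite mulf_eq0 (negbTE fx0) => /eqP.
Qed.

End LinearMapsOnJets.

Section Ext2.
Variables (R : realType) (n : nat) (M : manifold R n) (V : lmodType (smooth_fun M)).

Lemma dopN (d : derop V) v : d (- v) = - d v.
Proof.
have d0 : d 0 = 0 by apply: (@addrI _ (d 0)); rewrite -dopD !addr0.
by apply: (@addrI _ (d v)); rewrite -dopD !subrr.
Qed.

Lemma bivNE (P : bivec V) xi eta : (- P) xi eta = - P xi eta.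
Proof. by rewrite -scaleN1r bivZE mulN1r. Qed.

Lemma biv_linr (P : bivec V) f xi eta zeta :
  P xi (f *: eta + zeta) = f * P xi eta + P xi zeta.
Proof. by rewrite biv_skew biv_lin !(biv_skew P _ xi); ring. Qed.

Lemma ext2_eq (d e : derop V) : (forall v, d v = e v) ->
  (forall f, symb d f = symb e f) -> forall P : bivec V, ext2 d P = ext2 e P.
Proof.
move=> de sde P; have dual_de xi : ddual d xi = ddual e xi.
  by apply: dualP => v /=; rewrite sde de.
by apply: bivP => xi eta /=; rewrite sde !dual_de.
Qed.

Lemma ext2_comb (W : lmodType (smooth_fun M)) (q : W -> derop V) :
  derop_linear q -> forall f mu nu (P : bivec V),
  ext2 (q (f *: mu + nu)) P = f *: ext2 (q mu) P + ext2 (q nu) P.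
Proof.
move=> qlin f mu nu P; have [q1 q2] := qlin f mu nu.
have dq xi : ddual (q (f *: mu + nu)) xi = f *: ddual (q mu) xi + ddual (q nu) xi.
  apply: dualP => v; rewrite dualDE dualZE /= q1 q2 dual_lin; ring.
apply: bivP => xi eta; rewrite bivDE bivZE /= q2 !dq biv_lin biv_linr; ring.
Qed.

End Ext2.

Theorem proposition6p4 (R : realType) (n : nat) (M : manifold R n) (r : nat)
    (r_gt0 : (0 < r)%N) (E : vbundle M r)
    (LE : lie_algebroid (Gamma (vb_sections E)))
    (LE' : lie_algebroid (dual (Gamma (vb_sections E))))
    (p : Gamma (jet_sections E) -> derop (Gamma (vb_sections E)))
    (p_adjoint : is_adjoint LE p)
    (LJ : lie_algebroid (Gamma (jet_sections E)))
    (LJ_jet : is_jet_algebroid LE p LJ)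
    (dhat : {linear Gamma (jet_sections E) -> bivec (Gamma (vb_sections E))})
    (dhat_lift : is_dstar_lift LE' dhat) :
  (lie_bialgebroid LE LE' <-> is_cocycle LJ (tensor2 p) dhat) /\
  (coboundary_lie_bialgebroid LE LE' <-> is_coboundary (tensor2 p) dhat).
Proof.
have [plin pjet] := p_adjoint; have [brjet _ _ anchorJ] := LJ_jet.
have [hjet _] := dhat_lift.
have symb_jet u f : symb (p (jet u)) f = anchor LE u f.
  apply: smooth_funP => x; have [v vx0] := nonvanishing_section E x r_gt0.
  have := dop_leib (p (jet u)) f v; rewrite !pjet br_leib.
  move=> /addrI /(congr1 (fun s : Gamma (vb_sections E) => s x)).
  rewrite /= => /eqP; rewrite -subr_eq0 -scalerBl scaler_eq0 (negbTE vx0) orbF.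
  by rewrite subr_eq0 => /eqP.
have tensor_jet u P : tensor2 p (jet u) P = schouten12 LE u P.
  by apply: ext2_eq => [v|f]; rewrite ?symb_jet ?pjet.
have tensor_comb f mu nu P :
    tensor2 p (f *: mu + nu) P = f *: tensor2 p mu P + tensor2 p nu P.
  exact: ext2_comb.
split; split.
- move=> bialg.
  pose B mu nu := ce1 LJ (tensor2 p) dhat mu nu.
  have Bskew mu nu : B mu nu = - B nu mu.
    rewrite /B /ce1 (br_skew LJ mu) linearN !opprD !opprK; congr (_ + _); exact: addrC.
  have Blin nu f mu1 mu2 : B (f *: mu1 + mu2) nu = f *: B mu1 nu + B mu2 nu.
    have tensor_dhat : tensor2 p nu (dhat (f *: mu1 + mu2)) =
        f *: tensor2 p nu (dhat mu1) + symb (p nu) f *: dhat mu1 + tensor2 p nu (dhat mu2).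
      by rewrite linearP dopD dop_leib.
    have dhat_br : dhat (br LJ (f *: mu1 + mu2) nu) =
        f *: dhat (br LJ mu1 nu) - symb (p nu) f *: dhat mu1 + dhat (br LJ mu2 nu).
      by rewrite br_comb anchorJ linearP linearD linearN linearZ addrA.
    rewrite /B /ce1 tensor_comb tensor_dhat dhat_br.
    apply: bivP => xi eta; rewrite !(bivDE, bivNE, bivZE); ring.
  have Bjet u v : B (jet u) (jet v) = 0.
    rewrite /B /ce1 !tensor_jet brjet !hjet bialg /schouten21.
    by apply/eqP; rewrite subr_eq0 addrC.
  have Bjetr v mu : B mu (jet v) = 0.
    apply: (linear_jet_eq0 (B := B ^~ (jet v))) mu => [f mu1 mu2|u]; first exact: Blin.
    exact: Bjet.
  move=> mu nu; apply: (linear_jet_eq0 (B := B ^~ nu)) mu => [f mu1 mu2|u].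
    exact: Blin.
  by rewrite Bskew Bjetr oppr0.
- move=> coc u v; have := coc (jet u) (jet v).
  rewrite /ce1 !tensor_jet brjet !hjet /schouten21.
  by move=> /eqP; rewrite subr_eq0 => /eqP <-; rewrite addrC.
- move=> [tau dtau]; exists (- tau) => mu.
  apply/eqP; rewrite -subr_eq0; apply/eqP; move: mu.
  apply: linear_jet_eq0 => [f mu nu|u].
    rewrite /ce0 tensor_comb linearP /=.
    by rewrite scalerBr opprD addrACA.
  by rewrite /ce0 tensor_jet hjet dtau /schouten21 /schouten12 dopN subrr.
- move=> [w hw]; exists (- w) => u.
  by rewrite -hjet hw /ce0 tensor_jet /schouten21 /schouten12 dopN opprK.
Qed.
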